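(* Consider a monotone dynamical flow network on $\mathbb{R}_+^n$, $$\dot x = u + f(x),\qquad f(x)=F^{T}(x)\mathbf{1}-F(x)\mathbf{1}-w(x),$$ with external inflow vector $u\in\mathbb{R}_+^n$, possibly time-varying. Then: (i) the partial order between external inflows and initial states is preserved by the state at any time: if $x(t)$ and $\tilde x(t)$ are solutions with inflows $u$ and $\tilde u$, respectively, such that $x(0)\le\tilde x(0)$ and $u(t)\le\tilde u(t)$ for all $t\ge 0$, then $x(t)\le\tilde x(t)$ for all $t\ge 0$; (ii) the $l_1$-distance $\|x(t)-\tilde x(t)\|_1$ between any two solutions $x(t),\tilde x(t)$ (with the same inflow $u$) is non-increasing in $t$. Moreover, if the external inflows $u$ are constant in time, then: (iii) every equilibrium $x^*$ is stable; (iv) an equilibrium $x^*$ is globally asymptotically stable if and only if it is locally asymptotically stable; (v) an equilibrium $x^*$ at which $f$ is differentiable is (locally) asymptotically stable if the compartmental matrix $(\nabla f(x^* ))^{T}$ is outflow-connected; (vi) the trajectory started from $x(0)=0$ is entrywise monotonically non-decreasing in time, hence convergent to a (possibly infinite) limit.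
   Context: Dynamical flow network. Let $\mathcal{I}=\{1,\dots,n\}$ be a finite set of cells, $\mathcal{A}\subseteq\mathcal{I}\times\mathcal{I}$ with $(i,i)\notin\mathcal{A}$ for all $i$, and $\mathcal{R},\mathcal{S}\subseteq\mathcal{I}$. The state $x\in\mathbb{R}_+^n$ is the vector of masses in the cells; $u\in\mathbb{R}_+^n$ is the external inflow vector, with $u_i=0$ for $i\notin\mathcal{R}$; $F(x)\in\mathbb{R}_+^{n\times n}$ is the matrix of cell-to-cell flows, with $F_{ij}(x)=0$ for $(i,j)\notin\mathcal{A}$; $w(x)\in\mathbb{R}_+^n$ is the vector of outflows to the external environment, with $w_i(x)=0$ for $i\notin\mathcal{S}$. The dynamics is $$\dot x_i=u_i+\sum_{j}F_{ji}(x)-\sum_jF_{ij}(x)-w_i(x),\qquad i\in\mathcal{I},$$ and the flow functions satisfy: $x_i=0$ implies $w_i(x)+\sum_jF_{ij}(x)=0$, so that the nonnegative orthant $\mathbb{R}_+^n$ is invariant. Here $\mathbf{1}$ is the all-one vector, and inequalities between vectors are entrywise. Compartmental matrices. A square matrix $M$ is Metzler if $M_{ij}\ge0$ for all $i\ne j$, and compartmental if it is Metzler and $M\mathbf{1}\le 0$. A compartmental matrix $M$ is outflow-connected if, letting $\mathcal{A}_M=\{(i,j): i\neq j,\ M_{ij}>0\}$ and $\mathcal{S}_M=\{i:(M\mathbf{1})_i<0\}$, for every $i\in\mathcal{I}$ either $i\in\mathcal{S}_M$ or there is a directed path in the digraph $(\mathcal{I},\mathcal{A}_M)$ from $i$ to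 some $j\in\mathcal{S}_M$. Monotone dynamical flow network. The dynamical flow network is monotone (on the whole state space $\mathbb{R}_+^n$) if $F(x)$ and $w(x)$ are Lipschitz-continuous and $(\nabla f(x))^{T}$ is a compartmental matrix for almost every $x\in\mathbb{R}_+^n$, where $[\nabla f(x)]_{ij}=\partial f_i(x)/\partial x_j$; i.e., for almost every $x$, $$\sum_{k}\Big(\frac{\partial F_{ki}}{\partial x_j}(x)-\frac{\partial F_{ik}}{\partial x_j}(x)\Big)-\frac{\partial w_i}{\partial x_j}(x)\ge0\quad\text{for all } i\ne j,\qquad \sum_k\frac{\partial w_k}{\partial x_j}(x)\ge0\quad\text{for all } j.$$ Stability notions for equilibria are in the sense of Lyapunov, relative to the state space $\mathbb{R}_+^n$; global asymptotic stability means stability together with convergence to $x^*$ of the solution from every initial state in $\mathbb{R}_+^n$. *)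

(* Defs.v *)
From HB Require Import structures.
From mathcomp Require Import all_boot all_order all_algebra.
From mathcomp Require Import all_classical all_reals all_analysis.

Set Implicit Arguments.
Unset Strict Implicit.
Unset Printing Implicit Defensive.

Import Order.TTheory GRing.Theory Num.Theory.
Import numFieldNormedType.Exports.

Local Open Scope classical_set_scope.
Local Open Scope ring_scope.

Definition lev (R : numDomainType) (n : nat) (x y : 'cV[R]_n) : Prop :=
  forall i, x i 0 <= y i 0.
Notation "x <=v y" := (lev x y) (at level 70, no associativity) : ring_scope.

Definition orthant (R : realType) (n : nat) : set 'cV[R]_n :=
  [set x | 0 <=v x].
Arguments orthant : clear implicits.

Definition l1norm (R : numDomainType) (n : nat) (x : 'cV[R]_n) : R :=
  \sum_i `|x i 0|.

(* The library has no Lebesgue measure on R^n, but null sets suffice: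
   N is null when, for every e > 0, countably many open boxes
   prod_i ]a_k i, b_k i[ of total volume at most e cover it. *)
Definition lebesgue_null (R : realType) (n : nat) (N : set 'cV[R]_n) : Prop :=
  forall e : R, 0 < e -> exists a b : nat -> 'cV[R]_n,
    [/\ forall k, a k <=v b k,
        N `<=` \bigcup_k [set x | forall i, a k i 0 < x i 0 < b k i 0] &
        (\sum_(0 <= k <oo) (\prod_i (b k i 0 - a k i 0))%:E <= e%:E)%E].

Definition ae_orthant (R : realType) (n : nat) (P : set 'cV[R]_n) : Prop :=
  lebesgue_null (orthant R n `\` P).

Definition metzler (R : numDomainType) (n : nat) (M : 'M[R]_n) : Prop :=
  forall i j, i != j -> 0 <= M i j.

Definition ones (R : numDomainType) (n : nat) : 'cV[R]_n := const_mx 1.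
Arguments ones {R n}.

Definition compartmental (R : numDomainType) (n : nat) (M : 'M[R]_n) : Prop :=
  metzler M /\ M *m ones <=v 0.

Definition outflow_connected (R : numDomainType) (n : nat) (M : 'M[R]_n) :
    Prop :=
  let links := [rel i j : 'I_n | (i != j) && (0 < M i j)] in
  let sinks := [set i : 'I_n | (M *m ones) i 0 < 0]%SET in
  forall i : 'I_n, i \in sinks \/ exists2 j, j \in sinks & connect links i j.

(* The flow functions are total on R^n; only their values on the orthant are
   meaningful. *)
Record flow_network (R : realType) (n : nat) := FlowNetwork {
  links : {set 'I_n * 'I_n};
  inlets : {set 'I_n};
  outlets : {set 'I_n};
  flow : 'cV[R]_n -> 'M[R]_n;
  outflow : 'cV[R]_n -> 'cV[R]_n;
  links_irrefl : forall i, (i, i) \notin links;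
  flow_ge0 : forall x, orthant R n x -> forall i j, 0 <= flow x i j;
  flow_supp : forall x, orthant R n x ->
    forall i j, (i, j) \notin links -> flow x i j = 0;
  outflow_ge0 : forall x, orthant R n x -> 0 <=v outflow x;
  outflow_supp : forall x, orthant R n x ->
    forall i, i \notin outlets -> outflow x i 0 = 0;
  flow_empty : forall x, orthant R n x ->
    forall i, x i 0 = 0 -> outflow x i 0 + \sum_j flow x i j = 0
}.

Section dynamics.
Context (R : realType) (n : nat) (N : flow_network R n).

Definition vfield (x : 'cV[R]_n) : 'cV[R]_n :=
  (flow N x)^T *m ones - flow N x *m ones - outflow N x.

Definition admissible (u : 'cV[R]_n) : Prop :=
  0 <=v u /\ forall i, i \notin inlets N -> u i 0 = 0.

Definition inflow (u : R -> 'cV[R]_n) : Prop :=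
  (forall t, 0 <= t -> admissible (u t)) /\
  forall T i, (@lebesgue_measure R).-integrable `[0, T]
    (EFin \o (fun t => u t i 0)).

(* Integral (Caratheodory) form of x' = u + f(x), so that the inflow u need not
   be continuous; the state space is the orthant. *)
Definition solution (u x : R -> 'cV[R]_n) : Prop :=
  [/\ forall t, 0 <= t -> orthant R n (x t),
      {within `[0, +oo[, continuous x} &
      forall t, 0 <= t -> forall i,
        x t i 0 = x 0 i 0 +
          \int[@lebesgue_measure R]_(s in `[0, t])
             (u s i 0 + vfield (x s) i 0)].

Definition equilibrium (u xs : 'cV[R]_n) : Prop :=
  orthant R n xs /\ u + vfield xs = 0.

Definition stable (u xs : 'cV[R]_n) : Prop :=
  forall e : R, 0 < e -> exists2 d : R, 0 < d &
    forall x, solution (cst u) x -> `|x 0 - xs| < d ->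
      forall t, 0 <= t -> `|x t - xs| < e.

Definition locally_asymptotically_stable (u xs : 'cV[R]_n) : Prop :=
  stable u xs /\
  exists2 d : R, 0 < d &
    forall x, solution (cst u) x -> `|x 0 - xs| < d ->
      x t @[t --> +oo] --> xs.

Definition globally_asymptotically_stable (u xs : 'cV[R]_n) : Prop :=
  stable u xs /\
  forall x, solution (cst u) x -> x t @[t --> +oo] --> xs.

End dynamics.

Definition has_partials (R : realType) (n : nat) (f : 'cV[R]_n -> 'cV[R]_n)
    (x : 'cV[R]_n) : Prop :=
  forall i j, derivable (fun y => f y i 0 : R^o) x (delta_mx j 0).

Definition gradient (R : realType) (n : nat) (f : 'cV[R]_n -> 'cV[R]_n)
    (x : 'cV[R]_n) : 'M[R]_n :=
  \matrix_(i, j) 'D_(delta_mx j 0) (fun y => f y i 0 : R^o) x.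

(* f is differentiable at x relative to the orthant, with gradient G.  At an
   interior point G = gradient f x; at a boundary point (such as the origin)
   this only involves the values of f on the orthant, and still determines G. *)
Definition has_gradient (R : realType) (n : nat) (f : 'cV[R]_n -> 'cV[R]_n)
    (x : 'cV[R]_n) (G : 'M[R]_n) : Prop :=
  forall e : R, 0 < e -> \forall y \near within (orthant R n) (nbhs x),
    `|f y - f x - G *m (y - x)| <= e * `|y - x|.

(* The partial derivatives are two-sided, hence at boundary points depend on
   values outside the orthant; the boundary is a null set. *)
Definition monotone_network (R : realType) (n : nat) (N : flow_network R n) :
    Prop :=
  [/\ [lipschitz flow N x | x in orthant R n],
      [lipschitz outflow N x | x in orthant R n] &
      ae_orthant [set x | has_partials (vfield N) x /\
                          compartmental (gradient (vfield N) x)^T]].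

(* Main.v *)
(* The Jacobian condition holds only almost everywhere.  A null set meets some
   line parallel to a given axis, near any given one, in a set of arbitrarily
   small length (Markov's inequality, one coordinate at a time), and a Lipschitz
   function grows by little over such a set.  By continuity, f_i is then
   nondecreasing in x_j for all j <> i, and sum_i f_i is nonincreasing in every
   x_j, on the whole orthant.  Hence sum_i (x_i - x'_i)^+ has nonpositive upper
   right Dini derivative along two solutions with u <= u', which gives both the
   comparison principle and the l1-contraction without any Gronwall argument.

   Stability and monotone trajectories follow at once.  For global attraction,
   a trajectory at distance D from x* is compared with the one started from the
   point at distance rho of the segment to x*, which lies in the basin of x*;
   this uses existence of solutions, by Picard iteration.  For (v), outflow
   connectedness yields weights p > 0 with p^T G < 0, and sum_i p_i |x_i - x*_i|
   is a local strict Lyapunov function. *)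

Require Import Defs.
From HB Require Import structures.
From mathcomp Require Import all_boot all_order all_algebra.
From mathcomp Require Import all_classical all_reals all_analysis.
From mathcomp Require Import measurable_realfun ring lra.

Set Implicit Arguments.
Unset Strict Implicit.
Unset Printing Implicit Defensive.

Import Order.TTheory GRing.Theory Num.Theory.
Import numFieldNormedType.Exports.

Local Open Scope classical_set_scope.
Local Open Scope ring_scope.

(** * Dini derivatives *)

(** The inflow is only integrable on bounded intervals, so a solution need not be differentiable,
    and the differential equation cannot be used at a given time. In a difference [x - x'], however,
    [u - u'] keeps one sign and the rest of the integrand, [f(x) - f(x')], is continuous. Hence
    every coordinate of the difference satisfies a right Dini bound at every time, with no
    exceptional set. [dini_le] states such a bound multiplied out, without quotients or upper
    limits, and [dini_le_growth] is the single tool that integrates it. The same tool replaces the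
    fundamental theorem of calculus in the Picard estimates and in the time shift of integrals, and
    it handles growth along lines that cross a null set.

    Kinks are the other difficulty: positive parts and absolute values are not differentiable where
    two solutions share a coordinate. There the active set, or the sign vector, is settled by the
    sign of the rate.

    Functions that matter only for [t >= 0] are precomposed with [Num.max 0], which makes them
    continuous on the whole line. *)

Definition dini_le (R : realType) (V : R -> R) (s k : R) : Prop :=
  forall e : R, 0 < e -> \forall t \near s^'+, V t - V s <= (k + e) * (t - s).

Lemma dini_leW (R : realType) (V : R -> R) (s k k' : R) :
  k <= k' -> dini_le V s k -> dini_le V s k'.
Proof.
move=> kk' dV e e0; near=> t.
have st : s < t by near: t; exact: nbhs_right_gt.
apply: le_trans (_ : (k + e) * (t - s) <= _); first by near: t; exact: dV.
by rewrite ler_pM2r ?subr_gt0// lerD2r.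
Unshelve. all: by end_near. Qed.

Lemma near_eq_dini_le (R : realType) (V W : R -> R) (s k : R) :
  V s = W s -> (\forall t \near s^'+, V t = W t) ->
  dini_le V s k -> dini_le W s k.
Proof.
move=> VWs VW dV e e0; have {}dV := dV _ e0.
by near=> t; rewrite -VWs -(near VW t)//; near: t.
Unshelve. all: by end_near. Qed.

Lemma dini_leD (R : realType) (V W : R -> R) (s k l : R) :
  dini_le V s k -> dini_le W s l -> dini_le (fun t => V t + W t) s (k + l).
Proof.
move=> dV dW e e0; have e20 : 0 < e / 2 by rewrite divr_gt0.
have {}dV := dV _ e20; have {}dW := dW _ e20.
near=> t.
have h1 : V t - V s <= (k + e / 2) * (t - s) by near: t.
have h2 : W t - W s <= (l + e / 2) * (t - s) by near: t.
by lra.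
Unshelve. all: by end_near. Qed.

Lemma dini_le_cst (R : realType) (c s : R) : dini_le (fun=> c) s 0.
Proof.
move=> e e0; near=> t; rewrite subrr add0r mulr_ge0 ?ltW// subr_gt0.
by near: t; exact: nbhs_right_gt.
Unshelve. all: by end_near. Qed.

Lemma dini_leZ (R : realType) (V : R -> R) (s k c : R) :
  0 <= c -> dini_le V s k -> dini_le (fun t => c * V t) s (c * k).
Proof.
rewrite le_eqVlt => /predU1P[<-|c0] dV.
  rewrite mul0r; apply: near_eq_dini_le (@dini_le_cst R 0 s); rewrite ?mul0r//.
  by apply: nearW => t; rewrite mul0r.
move=> e e0; have {}dV := dV (e / c) (divr_gt0 e0 c0).
near=> t.
have h : V t - V s <= (k + e / c) * (t - s) by near: t.
by rewrite -mulrBr (le_trans (ler_wpM2l (ltW c0) h))// mulrA (mulrDr c k) mulrCA divff ?gt_eqF// mulr1.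
Unshelve. all: by end_near. Qed.

Lemma dini_le_sum (R : realType) (I : Type) (r : seq I) (V : I -> R -> R) (s : R)
    (k : I -> R) :
  (forall i, dini_le (V i) s (k i)) ->
  dini_le (fun t => \sum_(i <- r) V i t) s (\sum_(i <- r) k i).
Proof.
move=> dV; elim: r => [|i r IH].
  rewrite big_nil; apply: near_eq_dini_le (@dini_le_cst R 0 s).
    by rewrite big_nil.
  by apply: nearW => t; rewrite big_nil.
rewrite big_cons; apply: near_eq_dini_le (dini_leD (dV i) IH).
  by rewrite big_cons.
by apply: nearW => t; rewrite big_cons.
Qed.

(** Continuity fixes the sign of [V] just after [s] unless [V s = 0]. At a zero both branches may be
    active, so both conditions on [k'] apply there. *)
Lemma dini_le_max0 (R : realType) (V : R -> R) (s k k' : R) :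
  V t @[t --> s^'+] --> V s -> dini_le V s k ->
  (0 <= V s -> k <= k') -> (V s <= 0 -> 0 <= k') ->
  dini_le (fun t => Num.max 0 (V t)) s k'.
Proof.
move=> cV dV kk' k'0 e e0.
have {}dV := dV _ e0.
have [Vs|Vs|Vs] := ltrgtP (V s) 0.
- have Vneg : \forall t \near s^'+, V t < 0 by move/cvgr_lt : cV; apply.
  near=> t.
  rewrite /=; have -> : Num.max 0 (V t) = 0 by apply/max_idPl/ltW; near: t.
  rewrite subrr mulr_ge0//; first by rewrite addr_ge0 ?k'0 ?ltW.
  by rewrite subr_ge0 ltW//; near: t; exact: nbhs_right_gt.
- have Vpos : \forall t \near s^'+, 0 < V t by move/cvgr_gt : cV; apply.
  near=> t.
  rewrite /=; have -> : Num.max 0 (V t) = V t by apply/max_idPr/ltW; near: t.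
  have st : 0 <= t - s.
    by rewrite subr_ge0 ltW//; near: t; exact: nbhs_right_gt.
  rewrite (@le_trans _ _ ((k + e) * (t - s)))//; first by near: t.
  by rewrite ler_wpM2r// lerD2r kk' ?ltW.
- near=> t.
  have st : 0 <= t - s.
    by rewrite subr_ge0 ltW//; near: t; exact: nbhs_right_gt.
  have : V t - V s <= (k + e) * (t - s) by near: t.
  rewrite Vs !subr0 => h.
  have kk : k <= k' by rewrite kk' ?Vs.
  have k'_ge0 : 0 <= k' by rewrite k'0 ?Vs.
  rewrite ge_max mulr_ge0//=; last by rewrite addr_ge0 ?(ltW e0).
  by rewrite (le_trans h)// ler_wpM2r// lerD2r.
Unshelve. all: by end_near. Qed.

(** A bound on [- V] is also required, since the norm follows [- V] when [V] is negative; at a zero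
    of [V] both bounds are used. *)
Lemma dini_le_norm (R : realType) (V : R -> R) (s k k' : R) :
  V t @[t --> s^'+] --> V s ->
  dini_le V s k -> dini_le (fun t => - V t) s (- k) ->
  (0 <= V s -> k <= k') -> (V s <= 0 -> - k <= k') ->
  dini_le (fun t => `|V t|) s k'.
Proof.
move=> cV dV dNV kk' Nkk' e e0.
have {}dV := dV _ e0; have {}dNV := dNV _ e0.
have [Vs|Vs|Vs] := ltrgtP (V s) 0.
- have Vneg : \forall t \near s^'+, V t < 0 by move/cvgr_lt : cV; apply.
  near=> t.
  have st : 0 <= t - s.
    by rewrite subr_ge0 ltW//; near: t; exact: nbhs_right_gt.
  have Vt : V t < 0 by near: t.
  rewrite !ltr0_norm//.
  rewrite (@le_trans _ _ ((- k + e) * (t - s)))//; first by near: t.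
  by rewrite ler_wpM2r// lerD2r Nkk' ?ltW.
- have Vpos : \forall t \near s^'+, 0 < V t by move/cvgr_gt : cV; apply.
  near=> t.
  have st : 0 <= t - s.
    by rewrite subr_ge0 ltW//; near: t; exact: nbhs_right_gt.
  have Vt : 0 < V t by near: t.
  rewrite !gtr0_norm//.
  rewrite (@le_trans _ _ ((k + e) * (t - s)))//; first by near: t.
  by rewrite ler_wpM2r// lerD2r kk' ?ltW.
- near=> t.
  have st : 0 <= t - s.
    by rewrite subr_ge0 ltW//; near: t; exact: nbhs_right_gt.
  have h1 : V t - V s <= (k + e) * (t - s) by near: t.
  have h2 : - V t - - V s <= (- k + e) * (t - s) by near: t.
  have m1 : (k + e) * (t - s) <= (k' + e) * (t - s).
    by rewrite ler_wpM2r// lerD2r kk' ?Vs.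
  have m2 : (- k + e) * (t - s) <= (k' + e) * (t - s).
    by rewrite ler_wpM2r// lerD2r Nkk' ?Vs.
  rewrite Vs in h1 h2 *; rewrite normr0 subr0 ler_norml.
  by apply/andP; split; lra.
Unshelve. all: by end_near. Qed.

(* For e > 0, the last point of [a, b] where V - (k + e) id is at most its
   value at a cannot be to the left of b. *)
Lemma dini_le_growth (R : realType) (V : R -> R) (k a b : R) :
  a <= b -> continuous V -> (forall r : R, a <= r < b -> dini_le V r k) ->
  V b - V a <= k * (b - a).
Proof.
move=> ab cV dV.
suff growth e : 0 < e -> V b - V a <= (k + e) * (b - a).
  apply/ler_addgt0Pr => e e0.
  have ba1 : 0 < b - a + 1 by lra.
  apply: le_trans (growth _ (divr_gt0 e0 ba1)) _.
  rewrite mulrDl lerD2l mulrAC ler_pdivrMr// ler_wpM2l ?ltW//; lra.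
move=> e0; pose W t := V t - (k + e) * t.
have cW : continuous W.
  by move=> t; apply: cvgB; [exact: cV|apply: cvgM; [exact: cvg_cst|exact: cvg_id]].
pose A := `[a, b]%classic `&` [set t | W t <= W a].
have Aa : A a by split; rewrite /= ?in_itv/= ?lexx.
have clA : closed A.
  apply: closedI; first exact: interval_closed.
  apply: (@closed_comp _ _ W [set y | y <= W a]); last exact: closed_le.
  by move=> t _; exact: cW.
have Aub : has_ubound A.
  by exists b => t [/=]; rewrite in_itv/= => /andP[].
have Ac : A (sup A).
  have : closure A (sup A) by apply: closure_sup => //; exists a.
  by rewrite -(closure_id A).1.
have [cab Wc] := Ac; rewrite /= in_itv/= in cab Wc.
case/andP: cab => ac; rewrite le_eqVlt => /predU1P[<-|cb].
  by move: Wc; rewrite /W; lra.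
have dc : dini_le V (sup A) k by apply: dV; rewrite ac.
(* Points just to the right of [sup A] would still lie in [A]. *)
have : \forall t \near (sup A)^'+, False.
  have {}dc := dc _ e0.
  near=> t.
  have ct : sup A < t by near: t; exact: nbhs_right_gt.
  have tb : t < b by near: t; exact: nbhs_right_lt.
  have dt : V t - V (sup A) <= (k + e) * (t - sup A) by near: t.
  suff /(ub_le_sup Aub) : A t by rewrite leNgt ct.
  split; rewrite /= ?in_itv/=; first by rewrite !ltW// (le_lt_trans ac).
  by move: Wc; rewrite /W; lra.
by move/filter_ex => [].
Unshelve. all: by end_near. Qed.

(** * Norms and Lipschitz bounds *)

Lemma mx_coord_le_norm (R : realType) m n (A : 'M[R]_(m, n)) i j :
  `|A i j| <= `|A|.
Proof.
rewrite [leRHS]/Num.norm/= mx_normrE.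
exact: (le_bigmax _ (fun k => `|A k.1 k.2|) (i, j)).
Qed.

Lemma coord_le_norm (R : realType) n (x : 'cV[R]_n) i : `|x i 0| <= `|x|.
Proof. exact: mx_coord_le_norm. Qed.

Lemma cV_norm_le (R : realType) n (x : 'cV[R]_n) r :
  0 <= r -> (forall i, `|x i 0| <= r) -> `|x| <= r.
Proof.
move=> r0 xr; rewrite /Num.norm/= mx_normrE; apply/bigmax_leP; split => // -[i j] _.
by rewrite ord1.
Qed.

Lemma norm_le_l1norm (R : realType) n (x : 'cV[R]_n) : `|x| <= l1norm x.
Proof.
apply: cV_norm_le => [|i]; first exact: sumr_ge0.
by rewrite /l1norm (bigD1 i)//= lerDl sumr_ge0.
Qed.

Lemma l1norm_le_norm (R : realType) n (x : 'cV[R]_n) : l1norm x <= n%:R * `|x|.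
Proof.
rewrite /l1norm (le_trans (ler_sum _ (fun i _ => coord_le_norm x i)))//.
by rewrite sumr_const card_ord mulr_natl.
Qed.

Lemma l1norm_ge0 (R : realType) n (x : 'cV[R]_n) : 0 <= l1norm x.
Proof. exact: sumr_ge0. Qed.

Lemma l1normD (R : realType) n (x y : 'cV[R]_n) :
  l1norm (x + y) <= l1norm x + l1norm y.
Proof.
rewrite /l1norm -big_split/=; apply: ler_sum => i _.
by rewrite mxE ler_normD.
Qed.

Lemma l1normZ (R : realType) n (x : 'cV[R]_n) c :
  l1norm (c *: x) = `|c| * l1norm x.
Proof.
by rewrite /l1norm mulr_sumr; apply: eq_bigr => i _; rewrite mxE normrM.
Qed.

Lemma lipschitz_max0 (R : realType) (s t : R) :
  `|Num.max 0 s - Num.max 0 t| <= `|s - t|.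
Proof.
by case: (lerP 0 s) => s0; case: (lerP 0 t) => t0;
  case: (lerP s t) => st; rewrite ?subrr// ler_norml; apply/andP; split; lra.
Qed.

Lemma continuous_max0 (R : realType) : continuous (fun t : R => Num.max 0 t).
Proof.
move=> t; apply/cvgrPdist_lt => e e0; near=> s.
apply: le_lt_trans (lipschitz_max0 _ _) _; near: s.
by apply: cvgr_dist_lt => //; exact: cvg_id.
Unshelve. all: by end_near. Qed.

(** Trades continuity on the half-line for continuity on the whole line, the form that the growth
    lemma takes. *)
Lemma within_continuous_max (R : realType) (T : topologicalType) (f : R -> T) :
  {within `[0, +oo[, continuous f} -> continuous (fun t : R => f (Num.max 0 t)).
Proof.
move=> /subspace_continuousP cf t.
have m0 s : `[0, +oo[%classic (Num.max 0 s : R).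
  by rewrite /= in_itv/= le_max lexx.
move=> U fU; have := cf _ (m0 t) U fU; rewrite /= /within/= => nU.
have := @continuous_max0 R t _ nU; rewrite /= !nbhs_simpl/=.
by apply: filterS => s; apply; exact: m0.
Qed.

Definition lipschitz_orthant (R : realType) n (L : R) (g : 'cV[R]_n -> R) : Prop :=
  forall x y, orthant R n x -> orthant R n y -> `|g x - g y| <= L * `|x - y|.

Lemma continuous_lipschitz_orthant (R : realType) n (L : R) (g : 'cV[R]_n -> R)
    (z : R -> 'cV[R]_n) :
  lipschitz_orthant L g -> (forall t, orthant R n (z t)) -> continuous z ->
  continuous (fun t => g (z t)).
Proof.
move=> gL z0 cz t; apply/cvgrPdist_lt => e e0.
have L1 : 0 < `|L| + 1 by rewrite ltr_wpDl.
have eL : 0 < e / (`|L| + 1) by rewrite divr_gt0.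
have := cz t; move/cvgrPdist_lt/(_ _ eL); apply: filterS => s zs.
apply: le_lt_trans (gL _ _ (z0 t) (z0 s)) _.
apply: (@le_lt_trans _ _ ((`|L| + 1) * `|z t - z s|)).
  by rewrite ler_wpM2r// (le_trans (ler_norm _))// lerDl.
by rewrite mulrC -ltr_pdivlMr.
Qed.

Lemma lipschitz_bound (R : realType) (V W : normedModType R) (f : V -> W) (A : set V) :
  [lipschitz f x | x in A] ->
  exists2 L, 0 < L & forall x y, A x -> A y -> `|f x - f y| <= L * `|x - y|.
Proof.
move=> [M [Mr ML]]; exists (`|M| + 1); first by rewrite ltr_wpDl.
move=> x y Ax Ay.
by apply: (ML (`|M| + 1) _ (x, y)) => //; rewrite (le_lt_trans (ler_norm _))// ltrDl.
Qed.

Section vfield_lipschitz.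
Context (R : realType) (n : nat) (N : flow_network R n).

Lemma vfieldE x i :
  vfield N x i 0 = \sum_j flow N x j i - \sum_j flow N x i j - outflow N x i 0.
Proof.
rewrite /vfield !mxE; congr (_ - _ - _).
  by apply: eq_bigr => j _; rewrite !mxE mulr1.
by apply: eq_bigr => j _; rewrite !mxE mulr1.
Qed.

Lemma vfield_lipschitz : monotone_network N ->
  exists2 L : R, 0 < L & forall i, lipschitz_orthant L (fun x => vfield N x i 0).
Proof.
case=> /lipschitz_bound[K K0 hK] /lipschitz_bound[K' K'0 hK'] _.
have lipcoord i j x y : orthant R n x -> orthant R n y ->
    `|flow N x i j - flow N y i j| <= K * `|x - y|.
  move=> x0 y0; apply: le_trans (hK _ _ x0 y0).
  by have := mx_coord_le_norm (flow N x - flow N y) i j; rewrite !mxE.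
exists (n%:R * K + n%:R * K + K'); first by rewrite ltr_wpDl// addr_ge0// mulr_ge0// ltW.
move=> i x y x0 y0; rewrite !vfieldE.
have sumle (F G : 'I_n -> R) : (forall j, `|F j - G j| <= K * `|x - y|) ->
    `|\sum_j F j - \sum_j G j| <= n%:R * K * `|x - y|.
  move=> FG; rewrite -sumrB (le_trans (ler_norm_sum _ _ _))//.
  rewrite (le_trans (ler_sum _ (fun j _ => FG j)))//.
  by rewrite sumr_const card_ord -mulrA mulr_natl.
have h1 := sumle (fun j => flow N x j i) (fun j => flow N y j i)
  (fun j => lipcoord j i x y x0 y0).
have h2 := sumle (fun j => flow N x i j) (fun j => flow N y i j)
  (fun j => lipcoord i j x y x0 y0).
have h3 : `|outflow N x i 0 - outflow N y i 0| <= K' * `|x - y|.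
  apply: le_trans (hK' _ _ x0 y0).
  by have := coord_le_norm (outflow N x - outflow N y) i; rewrite !mxE.
rewrite !mulrDl; move: h1 h2 h3; rewrite !ler_norml.
move=> /andP[? ?] /andP[? ?] /andP[? ?]; apply/andP; split; lra.
Qed.

End vfield_lipschitz.

(** * Dini bounds for integrals and for differences of solutions *)

Lemma integrable_itvD (R : realType) (I : interval R) (a b : R -> R) :
  (@lebesgue_measure R).-integrable [set` I] (EFin \o a) ->
  (@lebesgue_measure R).-integrable [set` I] (EFin \o b) ->
  (@lebesgue_measure R).-integrable [set` I] (EFin \o (fun s => a s + b s)).
Proof.
move=> ia ib; apply: eq_integrable (integrableD _ ia ib) => // s _.
Qed.

Lemma integrable_continuous (R : realType) (g : R -> R) T : continuous g ->
  (@lebesgue_measure R).-integrable `[0, T] (EFin \o g).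
Proof.
move=> cg; apply: continuous_compact_integrable; first exact: segment_compact.
exact: continuous_subspaceT.
Qed.

Lemma ler_sub_swap (R : realDomainType) (p q r s u v w : R) :
  p - q = u -> r - s = v -> u <= v + w -> p - r - (q - s) <= w.
Proof. by move=> <- <-; lra. Qed.

(** Only the gap between [a] and [b] is controlled near [t]; each of them may be merely integrable,
    as inflows are. *)
Lemma dini_le_integral (R : realType) (a b : R -> R) (t k : R) :
  (forall T, (@lebesgue_measure R).-integrable `[0, T] (EFin \o a)) ->
  (forall T, (@lebesgue_measure R).-integrable `[0, T] (EFin \o b)) ->
  0 <= t ->
  (forall e : R, 0 < e -> \forall r \near t^'+, a r <= b r + (k + e)) ->
  dini_le (fun t => \int[@lebesgue_measure R]_(s in `[0, t]) a s -
                    \int[@lebesgue_measure R]_(s in `[0, t]) b s) t k.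
Proof.
move=> ia ib t0 ab e e0; have [d /= d0 hd] := ab e e0.
near=> t'.
have tt' : t < t' by near: t'; exact: nbhs_right_gt.
have td : t' < t + d by near: t'; apply: nbhs_right_lt; rewrite ltrDl.
have sub : (`]t, t']%classic : set R) `<=` `[0, t']%classic.
  by apply: subset_itvr; rewrite bnd_simp.
have ja : lebesgue_measure.-integrable `]t, t'] (EFin \o a) by apply: integrableS (ia t').
have jb : lebesgue_measure.-integrable `]t, t'] (EFin \o b) by apply: integrableS (ib t').
have Ea : \int[@lebesgue_measure R]_(s in `[0, t']) a s -
          \int[@lebesgue_measure R]_(s in `[0, t]) a s =
          \int[@lebesgue_measure R]_(s in `]t, t']) a s.
  by rewrite Rintegral_itvB// bnd_simp// ltW.
have Eb : \int[@lebesgue_measure R]_(s in `[0, t']) b s -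
          \int[@lebesgue_measure R]_(s in `[0, t]) b s =
          \int[@lebesgue_measure R]_(s in `]t, t']) b s.
  by rewrite Rintegral_itvB// bnd_simp// ltW.
have jc : (@lebesgue_measure R).-integrable `]t, t'] (EFin \o (fun=> k + e)).
  have : (@lebesgue_measure R).-integrable `[0, t'] (EFin \o (fun=> k + e)).
    by apply: integrable_continuous => ?; exact: cvg_cst.
  exact: integrableS.
have le1 : \int[@lebesgue_measure R]_(s in `]t, t']) a s <=
           \int[@lebesgue_measure R]_(s in `]t, t']) (b s + (k + e)).
  apply: le_Rintegral => //; first exact: integrable_itvD.
  move=> r /=; rewrite in_itv/= => /andP[tr rt'].
  apply: hd => //=; rewrite distrC ger0_norm ?subr_ge0 1?ltW//.
  by rewrite ltrBlDl (le_lt_trans rt').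
rewrite RintegralD// Rintegral_cst//= in le1.
have mE : fine (@lebesgue_measure R `]t, t']) = t' - t.
  by rewrite lebesgue_measure_itv/= lte_fin tt'.
rewrite mE in le1.
exact: ler_sub_swap Ea Eb le1.
Unshelve. all: by end_near. Qed.

Section solutions.
Context (R : realType) (n : nat) (N : flow_network R n).
Hypothesis hN : monotone_network N.

Lemma orthant_max (x : R -> 'cV[R]_n) :
  (forall t, 0 <= t -> orthant R n (x t)) ->
  forall t, orthant R n (x (Num.max 0 t)).
Proof. by move=> x0 t; apply: x0; rewrite le_max lexx. Qed.

Lemma continuous_vfield_solution u x i : solution N u x ->
  continuous (fun t : R => vfield N (x (Num.max 0 t)) i 0).
Proof.
case=> x0 cx _; have [L _ hL] := vfield_lipschitz hN.
apply: (continuous_lipschitz_orthant (hL i)); first exact: orthant_max.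
exact: within_continuous_max.
Qed.

Lemma solutionE u x : inflow N u -> solution N u x -> forall i,
  (forall T, (@lebesgue_measure R).-integrable `[0, T]
    (EFin \o (fun s => u s i 0 + vfield N (x (Num.max 0 s)) i 0))) /\
  (forall t, 0 <= t -> x t i 0 = x 0 i 0 + \int[@lebesgue_measure R]_(s in `[0, t])
             (u s i 0 + vfield N (x (Num.max 0 s)) i 0)).
Proof.
move=> [_ iu] sx i; split => [T|t t0].
  have iv := integrable_continuous T (continuous_vfield_solution (i := i) sx).
  exact: (integrable_itvD (iu T i) iv).
have [_ _ ->//] := sx; congr (_ + _); apply: eq_Rintegral => s.
by rewrite inE/= in_itv/= => /andP[s0 _]; rewrite (max_idPr s0).
Qed.

Lemma dini_le_solutionB u u' x x' i (t : R) :
  inflow N u -> inflow N u' -> solution N u x -> solution N u' x' ->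
  (forall t : R, 0 <= t -> u t <=v u' t) -> 0 <= t ->
  dini_le (fun t => x (Num.max 0 t) i 0 - x' (Num.max 0 t) i 0) t
    (vfield N (x t) i 0 - vfield N (x' t) i 0).
Proof.
move=> hu hu' sx sx' uu' t0.
have [ia Ea] := solutionE hu sx i; have [ib Eb] := solutionE hu' sx' i.
set k := _ - _.
have near_ab (e : R) : 0 < e -> \forall r \near t^'+,
    u r i 0 + vfield N (x (Num.max 0 r)) i 0 <=
    u' r i 0 + vfield N (x' (Num.max 0 r)) i 0 + (k + e).
  move=> e0.
  pose h (r : R) := vfield N (x (Num.max 0 r)) i 0 - vfield N (x' (Num.max 0 r)) i 0.
  have ch : h r @[r --> t] --> k.
    have /(_ t) cx := @continuous_vfield_solution _ _ i sx.
    have /(_ t) cx' := @continuous_vfield_solution _ _ i sx'.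
    rewrite /continuous_at !(max_idPr t0) in cx cx'.
    exact: cvgB.
  have : \forall r \near t^'+, h r < k + e.
    have /cvg_at_right_filter := ch; move/cvgr_lt; apply; by rewrite ltrDl.
  move=> hk; near=> r.
  have tr : t < r by near: r; exact: nbhs_right_gt.
  have hr : h r < k + e by near: r.
  have := uu' r (ltW (le_lt_trans t0 tr)) i; rewrite /h in hr; lra.
rewrite -(add0r k); apply: near_eq_dini_le (dini_leD (dini_le_cst (x 0 i 0 - x' 0 i 0) t)
  (dini_le_integral ia ib t0 near_ab)) => //.
- by rewrite (max_idPr t0) (Ea t)// (Eb t)// opprD [RHS]addrACA.
- near=> r.
  have r0 : 0 <= r.
    by rewrite (le_trans t0)// ltW//; near: r; exact: nbhs_right_gt.
  by rewrite (max_idPr r0) (Ea r)// (Eb r)// opprD [RHS]addrACA.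
Unshelve. all: by end_near. Qed.

Lemma continuous_solution_coord u x i : solution N u x ->
  continuous (fun t : R => x (Num.max 0 t) i 0).
Proof.
case=> _ cx _ t.
have /(_ t) cxt := within_continuous_max cx.
apply: (@cvg_comp _ _ _ (fun s : R => x (Num.max 0 s)) (fun M => M i 0) _ _ _ cxt).
exact: coord_continuous.
Qed.
End solutions.

(** * Sections of null sets *)

Lemma EFin_ge0 (R : numDomainType) (r : R) : 0 <= r -> (0 <= r%:E)%E.
Proof. by rewrite lee_fin. Qed.

(* Markov's inequality: the weight has integral at most e over the interval. *)
Lemma small_weight_point (R : realType) (c a b : nat -> R) (al w e : R) :
  0 < w -> 0 < e -> (forall k, 0 <= c k) -> (forall k, a k <= b k) ->
  (\sum_(0 <= k <oo) (c k * (b k - a k))%:E <= e%:E)%E ->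
  exists2 x, al < x < al + w &
    (\sum_(0 <= k <oo) (c k * (a k < x < b k)%R%:R)%:E <= (2 / w * e)%:E)%E.
Proof.
move=> w0 e0 c0 ab sume; apply: contrapT => noP.
pose mu := @lebesgue_measure R.
pose D : set (measurableTypeR R) := `]al, al + w[%classic.
pose f k (x : R) := ((c k)%:E * (\1_`]a k, b k[ x)%:E)%E.
have mI k : measurable_fun D (fun x : measurableTypeR R => (\1_`]a k, b k[ x)%:E : \bar R).
  by apply/measurable_EFinP; exact: measurable_indic.
have mf k : measurable_fun D (f k) by apply: measurable_funeM; exact: mI.
have f0 k x : D x -> (0 <= f k x)%E.
  by move=> _; rewrite /f -EFinM lee_fin mulr_ge0// indicE.
have muD : mu D = w%:E.
  by rewrite /mu /D lebesgue_measure_itv/= lte_fin ltrDl w0 -EFinD addrAC subrr add0r.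
have big x : D x -> ((2 / w * e)%:E <= \sum_(0 <= k <oo) f k x)%E.
  move=> Dx; have xD : al < x < al + w by move: Dx; rewrite /D/= in_itv.
  apply: contrapT => /negP; rewrite -ltNge => lt_sum.
  apply: noP; exists x => //; apply: le_trans (ltW lt_sum).
  apply: lee_nneseries => [k _ _|k _].
    by apply: EFin_ge0; rewrite mulr_ge0.
  by rewrite /f -EFinM indicE mem_setE in_itv/=.
(* If no point works, the weight is at least [2 / w * e] on an interval of length [w]. The factor 2
   makes its integral at least [2 * e], strictly more than [e]. *)
have : (\int[mu]_(x in D) (2 / w * e)%:E <= \int[mu]_(x in D) \sum_(0 <= k <oo) f k x)%E.
  apply: ge0_le_integral => //; first exact: measurable_itv.
  - by move=> x _; apply: EFin_ge0; rewrite mulr_ge0 ?divr_ge0 ?ltW.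
  - by apply: ge0_emeasurable_sum => [k x Dx _|k _]; [exact: f0|exact: mf].
rewrite integral_cst; last exact: measurable_itv.
rewrite [X in (_ * X)%E]muD integral_nneseries//; last exact: measurable_itv.
rewrite -EFinM.
have -> : 2 / w * e * w = 2 * e by rewrite mulrAC divfK ?gt_eqF.
apply/negP; rewrite -ltNge; apply: (@le_lt_trans _ _ e%:E); last first.
  by rewrite lte_fin; lra.
apply: le_trans sume; apply: lee_nneseries => [k _ _|k _].
  by apply: integral_ge0 => x; exact: f0.
have indic_ge0 x : D x -> (0 <= (\1_`]a k, b k[ x)%:E :> \bar R)%E.
  by move=> _; apply: EFin_ge0; rewrite indicE.
rewrite /f (ge0_integralZl_EFin _ _ indic_ge0)//; last exact: measurable_itv.
rewrite integral_indic//; last exact: measurable_itv.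
rewrite EFinM lee_wpmul2l ?lee_fin//.
apply: (@le_trans _ _ (mu `]a k, b k[%classic)).
  by apply: le_measure; rewrite ?inE//; apply: measurableI; exact: measurable_itv.
rewrite /mu lebesgue_measure_itv/= lte_fin; case: ifP => // _.
by rewrite lee_fin subr_ge0.
Qed.

Section box_sections.
Context (R : realType) (n : nat) (a b : nat -> 'cV[R]_n).

(* The volume of the k-th box with each coordinate in s frozen at its value in
   x: such a coordinate contributes an indicator instead of a length. *)
Definition section_weight (s : seq 'I_n) (x : 'cV[R]_n) (k : nat) : R :=
  \prod_i (if i \in s then (a k i 0 < x i 0 < b k i 0)%R%:R else b k i 0 - a k i 0).

Definition set_coord (x : 'cV[R]_n) (j : 'I_n) (y : R) : 'cV[R]_n :=
  \col_i (if i == j then y else x i 0).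

(** Freezing one more coordinate multiplies the bound by [2 / w]. The other factors of each product
    do not involve that coordinate and serve as the weights in [small_weight_point]. *)
Lemma small_section (x0 : 'cV[R]_n) (w e : R) (s : seq 'I_n) :
  (forall k, a k <=v b k) -> 0 < w -> 0 < e -> uniq s ->
  (\sum_(0 <= k <oo) (\prod_i (b k i 0 - a k i 0))%:E <= e%:E)%E ->
  exists2 x : 'cV[R]_n, (forall i, x0 i 0 < x i 0 < x0 i 0 + w) &
    (\sum_(0 <= k <oo) (section_weight s x k)%:E <= ((2 / w) ^+ size s * e)%:E)%E.
Proof.
move=> ab w0 e0 + sume; elim: s => [_|i s IH /= /andP[iNs us]].
  exists (x0 + const_mx (w / 2)) => [i|]; first by rewrite !mxE; lra.
  by rewrite expr0 mul1r (le_trans _ sume).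
have [x xw sumx] := IH us.
pose c k := \prod_(l | l != i) (if l \in s then (a k l 0 < x l 0 < b k l 0)%R%:R : R
                               else b k l 0 - a k l 0).
have c0 k : 0 <= c k.
  by apply: prodr_ge0 => l _; case: ifP => // _; rewrite subr_ge0; exact: ab.
have cE k : section_weight s x k = c k * (b k i 0 - a k i 0).
  by rewrite /section_weight (bigD1 i)//= (negbTE iNs) mulrC.
have e1 : 0 < (2 / w) ^+ size s * e by rewrite mulr_gt0// exprn_gt0// divr_gt0.
have [|y yw sumy] := @small_weight_point R c (fun k => a k i 0) (fun k => b k i 0)
    (x0 i 0) w _ w0 e1 c0 (fun k => ab k i).
  by under eq_eseriesr do rewrite -cE.
exists (set_coord x i y) => [l|].
  by rewrite mxE; case: eqP => [->//|_]; exact: xw.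
rewrite exprS -mulrA; apply: le_trans sumy; apply: lee_nneseries => [k _ _|k _].
  apply: EFin_ge0; apply: prodr_ge0 => l _; case: ifP => // _.
  by rewrite subr_ge0; exact: ab.
rewrite lee_fin /section_weight (bigD1 i)//= mxE eqxx in_cons eqxx/= mulrC.
rewrite le_eqVlt; apply/orP; left; apply/eqP; congr (_ * _).
apply: eq_bigr => l li; rewrite in_cons (negbTE li)/= mxE (negbTE li).
by [].
Qed.

End box_sections.

(** With every coordinate except [j] frozen, the weight of a box is its length along axis [j], or 0
    if the line misses the box. *)
Lemma null_line (R : realType) n (A : set 'cV[R]_n) (x0 : 'cV[R]_n) (j : 'I_n)
    (w d : R) :
  lebesgue_null A -> 0 < w -> 0 < d ->
  exists2 x : 'cV[R]_n, (forall i, x0 i 0 < x i 0 < x0 i 0 + w) &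
    exists a b : nat -> R,
    [/\ forall k, a k <= b k, (\sum_(0 <= k <oo) (b k - a k)%:E <= d%:E)%E &
      forall y, A (set_coord x j y) -> exists k, a k < y < b k].
Proof.
move=> A0 w0 d0.
pose s := [seq i <- enum 'I_n | i != j].
have us : uniq s by rewrite filter_uniq// enum_uniq.
have jNs : j \in s = false by rewrite mem_filter eqxx.
have ins i : i != j -> i \in s by rewrite mem_filter mem_enum => ->.
have w2 : 0 < (2 / w) ^+ size s by rewrite exprn_gt0// divr_gt0.
(* The volume of the cover is chosen so that freezing all the coordinates in [s] leaves exactly
   [d]. *)
have e0 : 0 < d / (2 / w) ^+ size s by rewrite divr_gt0.
have [a [b [ab Acov sume]]] := A0 _ e0.
have [x xw sumx] := small_section x0 ab w0 e0 us sume.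
exists x => //.
pose P k := [forall i, (i != j) ==> (a k i 0 < x i 0 < b k i 0)].
(* A box missed by the line becomes the empty interval []0, 0[]. *)
exists (fun k => if P k then a k j 0 else 0), (fun k => if P k then b k j 0 else 0).
split.
- by move=> k; case: ifP => // _; exact: ab.
- rewrite mulrC divfK ?gt_eqF// in sumx.
  apply: le_trans sumx; apply: lee_nneseries => [k _ _|k _].
    by apply: EFin_ge0; case: ifP => _; rewrite ?subrr// subr_ge0; exact: ab.
  rewrite lee_fin /section_weight (bigD1 j)//= jNs; case: ifPn => [/forallP Pk|_].
    rewrite big1 ?mulr1// => i ij; rewrite ins//.
    by have := Pk i; rewrite ij/= => ->.
  rewrite subrr mulr_ge0// ?subr_ge0; first exact: ab.
  by apply: prodr_ge0 => i ij; rewrite ins.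
- move=> y /Acov[k _ /= kx]; exists k.
  have -> : P k.
    apply/forallP => i; apply/implyP => ij.
    by have := kx i; rewrite mxE (negbTE ij).
  by have := kx j; rewrite mxE eqxx.
Qed.

(** * Growth of a Lipschitz function across a cover of small length *)

Lemma continuous_lipschitz (R : realType) (h : R -> R) (L : R) :
  (forall s t, `|h s - h t| <= L * `|s - t|) -> continuous h.
Proof.
move=> hL t; apply/cvgrPdist_lt => e e0.
have L1 : 0 < `|L| + 1 by rewrite ltr_wpDl.
near=> s; apply: le_lt_trans (hL _ _) _.
apply: (@le_lt_trans _ _ ((`|L| + 1) * `|t - s|)).
  by rewrite ler_wpM2r// (le_trans (ler_norm _))// lerDl.
rewrite mulrC -ltr_pdivlMr//; near: s.
by apply: cvgr_dist_lt; [exact: cvg_id|rewrite divr_gt0].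
Unshelve. all: by end_near. Qed.

Section cover_length.
Context (R : realType) (U : set R) (p : R).
Hypothesis mU : measurable U.
Local Notation mu := (@lebesgue_measure R).

(** A compensator: its slope is 1 along intervals inside [U] and between 0 and 1 everywhere, so
    subtracting a multiple of it offsets growth inside [U] and does no harm outside. *)
Definition cover_length (t : R) : R := fine (mu (U `&` `[p, t])).

Let mUI (I : interval R) : measurable (U `&` [set` I]).
Proof. by apply: measurableI => //; exact: measurable_itv. Qed.

Let mu_itv_fin (I : interval R) (s t : R) :
  [set` I] `<=` `[s, t] -> mu (U `&` [set` I]) \is a fin_num.
Proof.
move=> Ist; rewrite ge0_fin_numE//.
apply: (@le_lt_trans _ _ (mu `[s, t]%classic)).
  apply: le_measure; rewrite ?inE//; first exact: mUI.
  by apply: subset_trans Ist; exact: subIsetr.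
by rewrite lebesgue_measure_itv/=; case: ifP => _; rewrite -?EFinD ltry.
Qed.

Lemma cover_lengthB (s t : R) : s <= t ->
  cover_length t - cover_length s = fine (mu (U `&` (`[p, t] `&` `]s, t]))).
Proof.
move=> st; rewrite /cover_length.
have -> : mu (U `&` `[p, t]) =
    (mu (U `&` `[p, s]) + mu (U `&` (`[p, t] `&` `]s, t])))%E.
  rewrite -measureU//.
  - congr (mu _); apply/seteqP; split => x /=; rewrite !in_itv/=.
      move=> [Ux /andP[px xt]]; case: (lerP x s) => xs; [left|right]; rewrite ?px//.
    move=> [[Ux /andP[px xs]]|[Ux [pxt _]]]; last by rewrite pxt.
    by rewrite px (le_trans xs st).
  - exact: mUI.
  - by apply: measurableI => //; apply: measurableI; exact: measurable_itv.
  - rewrite -subset0 => x /=; rewrite !in_itv/=.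
    by move=> [[_ /andP[_ xs]] [_ [_ /andP[sx _]]]]; move: sx; rewrite ltNge xs.
rewrite fineD; first by rewrite addrAC subrr add0r.
  exact: (mu_itv_fin (@subset_refl _ _)).
rewrite -set_itvI; apply: (mu_itv_fin (s := s) (t := t)).
by rewrite set_itvI => x /= [_]; rewrite !in_itv/= => /andP[/ltW-> ->].
Qed.

Lemma cover_length_bounds (s t : R) : s <= t ->
  0 <= cover_length t - cover_length s <= t - s.
Proof.
move=> st; rewrite cover_lengthB// fine_ge0//=.
have mst : mu `]s, t]%classic = (t - s)%:E.
  rewrite lebesgue_measure_itv/= lte_fin; case: ltP => // ts.
  by have -> : s = t by [apply/eqP; rewrite eq_le st]; rewrite subrr.
rewrite -[leRHS]/(fine (t - s)%:E) -mst fine_le//.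
- rewrite -set_itvI; apply: (mu_itv_fin (s := s) (t := t)).
  by rewrite set_itvI => x /= [_]; rewrite !in_itv/= => /andP[/ltW-> ->].
- by rewrite mst.
- apply: le_measure; rewrite ?inE.
  + by apply: measurableI => //; apply: measurableI; exact: measurable_itv.
  + exact: measurable_itv.
  + by move=> x [_ []].
Qed.

Lemma cover_length_inside (s t : R) : p <= s -> s <= t -> `]s, t] `<=` U ->
  cover_length t - cover_length s = t - s.
Proof.
move=> ps st sU; rewrite cover_lengthB//.
have -> : U `&` (`[p, t] `&` `]s, t]) = `]s, t]%classic.
  apply/seteqP; split => [x [_ []]//|x stx].
  split; [exact: sU|split => //].
  by move: stx; rewrite /= !in_itv/= => /andP[/ltW/(le_trans ps)-> ->].
rewrite lebesgue_measure_itv/= lte_fin; case: ltP => //= ts.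
by have -> : s = t by [apply/eqP; rewrite eq_le st]; rewrite subrr.
Qed.

Lemma continuous_cover_length : continuous cover_length.
Proof.
apply: (@continuous_lipschitz _ _ 1) => s t; rewrite mul1r.
have [st|/ltW st] := leP s t.
  rewrite distrC [leRHS]distrC; have /andP[c0 c1] := cover_length_bounds st.
  by rewrite !ger0_norm// subr_ge0.
have /andP[c0 c1] := cover_length_bounds st.
by rewrite !ger0_norm// subr_ge0.
Qed.

End cover_length.

(* Where the derivative of h is not controlled, h grows by at most L times the
   length of the intervals, so h - L * cover_length does not grow at all. *)
Lemma lipschitz_growth_off_cover (R : realType) (h : R -> R) (a b : nat -> R)
    (L d p q : R) :
  0 <= L -> (forall s t, `|h s - h t| <= L * `|s - t|) ->
  (forall k, a k <= b k) -> (\sum_(0 <= k <oo) (b k - a k)%:E <= d%:E)%E ->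
  p <= q ->
  (forall t, p <= t < q -> (exists k, a k < t < b k) \/ dini_le h t 0) ->
  h q - h p <= L * d.
Proof.
move=> L0 hL ab sumd pq hdini.
pose U := \bigcup_k `]a k, b k[%classic : set R.
have mU : measurable U by apply: bigcup_measurable => k _; exact: measurable_itv.
have ch := continuous_lipschitz hL.
pose V t := h t - L * cover_length U p t.
have cV : continuous V.
  move=> t; apply: cvgB; first exact: ch.
  by apply: cvgM; [exact: cvg_cst|exact: continuous_cover_length].
have VV : V q - V p <= 0 * (q - p).
  apply: dini_le_growth => // t ptq e e0.
  have [[k /andP[akt tbk]]|dh] := hdini t ptq; near=> r.
  - have tr : t < r by near: r; exact: nbhs_right_gt.
    have rb : r < b k by near: r; exact: nbhs_right_lt.
    have lr : cover_length U p r - cover_length U p t = r - t.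
      apply: (cover_length_inside mU _ (ltW tr)); first by case/andP: ptq.
      move=> x /=; rewrite in_itv/= => /andP[tx xr]; exists k => //=.
      by rewrite in_itv/= (lt_trans akt tx) (le_lt_trans xr rb).
    have rt0 : 0 <= r - t by rewrite subr_ge0 ltW.
    have hr : h r - h t <= L * (r - t).
      by rewrite -[X in L * X]ger0_norm// (le_trans (ler_norm _)).
    have er : 0 <= e * (r - t) by rewrite mulr_ge0// ltW.
    have Lr : L * (cover_length U p r - cover_length U p t) = L * (r - t) by rewrite lr.
    rewrite /V add0r; lra.
  - have tr : t < r by near: r; exact: nbhs_right_gt.
    have hr : h r - h t <= (0 + e) * (r - t) by near: r; exact: dh.
    have /andP[c0 _] := cover_length_bounds p mU (ltW tr).
    have Lr : 0 <= L * (cover_length U p r - cover_length U p t) by rewrite mulr_ge0.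
    rewrite /V; lra.
have len0 : 0 <= cover_length U p p by rewrite fine_ge0.
have lend : cover_length U p q <= d.
  have muU : (lebesgue_measure U <= d%:E)%E.
    apply: le_trans sumd.
    apply: (@le_trans _ _ (\sum_(0 <= k <oo) lebesgue_measure (`]a k, b k[%classic : set R))%E).
      by apply: measure_sigma_subadditive => // k; exact: measurable_itv.
    apply: lee_nneseries => // k _.
    rewrite lebesgue_measure_itv/= lte_fin; case: ifP => // _.
    by apply: EFin_ge0; rewrite subr_ge0.
  have mUq : (lebesgue_measure (U `&` `[p, q]) <= d%:E)%E.
    apply: le_trans muU; apply: le_measure; rewrite ?inE//.
    by apply: measurableI => //; exact: measurable_itv.
  rewrite /cover_length -lee_fin fineK// ge0_fin_numE//.
  by apply: le_lt_trans mUq _; rewrite ltry.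
have : L * cover_length U p q <= L * d by rewrite ler_wpM2l.
have : 0 <= L * cover_length U p p by rewrite mulr_ge0.
rewrite /V in VV; lra.
Unshelve. all: by end_near. Qed.

(** * Monotonicity from derivatives known almost everywhere *)

Lemma quotient_errorE (R : fieldType) (k X D : R) :
  k != 0 -> X - D * k = - (k * (D - k^-1 * X)).
Proof. by move=> k0; rewrite mulrBr mulVKf// opprB mulrC. Qed.

Section coordinatewise_monotone.
Context (R : realType) (n : nat).
Implicit Types (g : 'cV[R]_n -> R) (x y : 'cV[R]_n).

Lemma set_coord_set_coord x (j : 'I_n) (s t : R) :
  set_coord (set_coord x j s) j t = set_coord x j t.
Proof. by apply/colP => i; rewrite !mxE; case: eqP. Qed.

Lemma set_coord_dist x (j : 'I_n) (s t : R) :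
  `|set_coord x j s - set_coord x j t| <= `|s - t|.
Proof.
apply: cV_norm_le => // i; rewrite !mxE; case: eqP => // _.
by rewrite subrr normr0.
Qed.

Lemma orthant_set_coord x (j : 'I_n) (s : R) :
  orthant R n x -> 0 <= s -> orthant R n (set_coord x j s).
Proof.
move=> x0 s0 i; rewrite !mxE; case: eqP => // _.
by have := x0 i; rewrite mxE.
Qed.

(** The point [x] may lie on the boundary, and its own line may meet [A] in a large set. The
    estimate is therefore made on a nearby line of the open orthant and carried back by Lipschitz
    continuity. *)
Lemma coord_monotone g (L : R) (A : set 'cV[R]_n) (j : 'I_n) :
  0 <= L -> lipschitz_orthant L g -> lebesgue_null A ->
  (forall y, (forall i, 0 < y i 0) -> ~ A y ->
     dini_le (fun t => - g (set_coord y j t)) (y j 0) 0) ->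
  forall x (h : R), orthant R n x -> 0 <= h -> g x <= g (set_coord x j (x j 0 + h)).
Proof.
move=> L0 gL A0 gdini x h x0 h0; apply/ler_addgt0Pr => e e0.
have L1 : 0 < 3 * (L + 1) by lra.
(* Three errors of size [L * w] must fit into [e]: one for moving each endpoint and one for the
   growth over the cover. Using [L + 1] allows [L = 0]. *)
pose w := e / (3 * (L + 1)); have w0 : 0 < w by rewrite divr_gt0.
have Lw : 3 * (L * w) <= e.
  rewrite mulrA /w mulrA ler_pdivrMr// mulrC ler_wpM2l ?ltW//; lra.
have [z xz [a [b [ab sumab cov]]]] := null_line x j A0 w0 w0.
have xi0 i : 0 <= x i 0 by have := x0 i; rewrite mxE.
have z0 i : 0 < z i 0 by have /andP[+ _] := xz i; apply: le_lt_trans.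
have zO : orthant R n z by move=> i; rewrite mxE ltW.
(* Starting at [x j 0 + w > 0] keeps the segment inside the open orthant and its endpoints within
   [w] of the intended ones. *)
pose p := x j 0 + w; pose q := p + h.
have p0 : 0 < p by rewrite /p ltr_wpDl.
have pq : p <= q by rewrite /q lerDl.
pose G t := - g (set_coord z j (Num.max 0 t)).
have max_ge0 (t : R) : 0 <= Num.max 0 t by rewrite le_max lexx.
have GL s t : `|G s - G t| <= L * `|s - t|.
  rewrite /G -opprD normrN.
  apply: le_trans (gL _ _ (orthant_set_coord j zO (max_ge0 s))
                          (orthant_set_coord j zO (max_ge0 t))) _.
  apply: ler_wpM2l => //; apply: le_trans (set_coord_dist _ _ _ _) _.
  exact: lipschitz_max0.
have Gdini t : p <= t < q -> (exists k, a k < t < b k) \/ dini_le G t 0.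
  move=> /andP[pt tq]; have t0 : 0 < t by exact: lt_le_trans pt.
  have [/cov?|nA] := pselect (A (set_coord z j t)); [by left|right].
  have := gdini (set_coord z j t); rewrite mxE eqxx => dz.
  apply: near_eq_dini_le (dz _ nA).
  - by rewrite /G set_coord_set_coord (max_idPr (ltW t0)).
  - near=> s; rewrite /G set_coord_set_coord (max_idPr _)//.
    by rewrite (le_trans (ltW t0))// ltW//; near: s; exact: nbhs_right_gt.
  - by move=> i; rewrite mxE; case: ifP.
have Gpq := lipschitz_growth_off_cover L0 GL ab sumab pq Gdini.
rewrite /G (max_idPr (ltW p0)) (max_idPr (le_trans (ltW p0) pq)) in Gpq.
have near1 : `|set_coord z j p - x| <= w.
  apply: cV_norm_le => [|i]; first exact: ltW.
  rewrite !mxE; have [->|_] := eqVneq i j; first by rewrite /p addrAC subrr add0r gtr0_norm.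
  by have /andP[z1 z2] := xz i; rewrite ler_norml; apply/andP; split; lra.
have near2 : `|set_coord z j q - set_coord x j (x j 0 + h)| <= w.
  apply: cV_norm_le => [|i]; first exact: ltW.
  rewrite !mxE; have [_|_] := eqVneq i j.
    by rewrite /q /p ler_norml; apply/andP; split; lra.
  by have /andP[z1 z2] := xz i; rewrite ler_norml; apply/andP; split; lra.
have O1 := orthant_set_coord j zO (ltW p0).
have O2 := orthant_set_coord j zO (le_trans (ltW p0) pq).
have O3 := orthant_set_coord j x0 (addr_ge0 (xi0 j) h0).
have d1 := le_trans (gL _ _ O1 x0) (ler_wpM2l L0 near1).
have d2 := le_trans (gL _ _ O2 O3) (ler_wpM2l L0 near2).
move: d1 d2; rewrite !ler_norml => /andP[? ?] /andP[? ?].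
by lra.
Unshelve. all: by end_near. Qed.

(** The coordinates are changed one at a time; each hybrid of [x] and [y] lies above [x], hence
    stays in the orthant. *)
Lemma coordwise_monotone g (P : pred 'I_n) :
  (forall j, P j -> forall x (h : R), orthant R n x -> 0 <= h ->
     g x <= g (set_coord x j (x j 0 + h))) ->
  forall x y, orthant R n x -> x <=v y -> (forall i, ~~ P i -> x i 0 = y i 0) ->
  g x <= g y.
Proof.
move=> gP x y x0 xy xPy.
pose z (s : seq 'I_n) : 'cV[R]_n := \col_i (if i \in s then y i 0 else x i 0).
have -> : y = z (enum 'I_n) by apply/colP => i; rewrite mxE mem_enum.
elim: (enum _) => [|j s IH].
  by have -> : z [::] = x by [apply/colP => i; rewrite mxE].
apply: le_trans IH _.
have zO : orthant R n (z s).
  move=> i; rewrite !mxE; have := x0 i; rewrite mxE => xi0.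
  by case: ifP => // _; exact: le_trans (xy i).
have zy : z s j 0 <= y j 0 by rewrite mxE; case: ifP.
have zE : z (j :: s) = set_coord (z s) j (z s j 0 + (y j 0 - z s j 0)).
  rewrite subrKC; apply/colP => i; rewrite !mxE in_cons.
  by case: eqP => [->|].
have [Pj|Pj] := boolP (P j); first by rewrite zE; apply: gP => //; rewrite subr_ge0.
suff -> : z (j :: s) = z s by [].
apply/colP => i; rewrite !mxE in_cons; case: eqP => //= ->.
by rewrite xPy// if_same.
Qed.

(** Both signs are recorded: the first serves the mass inequality, the second quasimonotonicity. *)
Lemma dini_le_derivable (G : 'cV[R]_n -> R^o) x (j : 'I_n) :
  derivable G x (delta_mx j 0) ->
  dini_le (fun t => G (set_coord x j t)) (x j 0) ('D_(delta_mx j 0) G x) /\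
  dini_le (fun t => - G (set_coord x j t)) (x j 0) (- 'D_(delta_mx j 0) G x).
Proof.
move=> dG.
have cD : h^-1 *: (G (h *: delta_mx j 0 + x) - G x) @[h --> 0^'] -->
  'D_(delta_mx j 0) G x by [].
set D := 'D_(delta_mx j 0) G x in cD *.
have near_quot (e : R) : 0 < e -> \forall t \near (x j 0)^'+,
    `|G (set_coord x j t) - G x - D * (t - x j 0)| <= e * (t - x j 0).
  move=> e0; move/cvgrPdist_lt : cD => /(_ _ e0)[d /= d0 hd].
  near=> t.
  have xt : x j 0 < t by near: t; exact: nbhs_right_gt.
  have td : t < x j 0 + d by near: t; apply: nbhs_right_lt; rewrite ltrDl.
  have h0 : 0 < t - x j 0 by rewrite subr_gt0.
  have hball : `|0 - (t - x j 0)| < d by rewrite sub0r normrN gtr0_norm// ltrBlDl.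
  have hne : t - x j 0 != 0 by rewrite gt_eqF.
  have := ltW (hd _ hball hne).
  have -> : (t - x j 0) *: delta_mx j 0 + x = set_coord x j t.
    apply/colP => i; rewrite !mxE eqxx andbT; case: eqP => [->|_].
      by rewrite mulr1 subrK.
    by rewrite mulr0 add0r.
  rewrite /GRing.scale/=; set X := G _ - G x => hX.
  have -> : X - D * (t - x j 0) = - ((t - x j 0) * (D - (t - x j 0)^-1 * X)).
    exact: quotient_errorE.
  by rewrite normrN normrM (gtr0_norm h0) mulrC ler_wpM2r// ltW.
have xE : set_coord x j (x j 0) = x.
  by apply/colP => i; rewrite mxE; case: eqP => [->|].
split=> e e0; have {}near_quot := near_quot _ e0; near=> t.
  have : `|G (set_coord x j t) - G x - D * (t - x j 0)| <= e * (t - x j 0) by near: t.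
  by rewrite xE ler_norml mulrDl => /andP[_]; rewrite lerBlDl.
have : `|G (set_coord x j t) - G x - D * (t - x j 0)| <= e * (t - x j 0) by near: t.
by rewrite xE ler_norml => /andP[+ _]; lra.
Unshelve. all: by end_near. Qed.

End coordinatewise_monotone.

(** * Comparison of solutions *)

Section comparison.
Context (R : realType) (n : nat) (N : flow_network R n).
Hypothesis hN : monotone_network N.
Implicit Types (x y : 'cV[R]_n) (i : 'I_n).
Local Notation f x i := (vfield N x i 0).

(** The Metzler condition gives no sign to the diagonal derivatives, which is why coordinate [i] is
    held fixed. *)
Lemma vfield_quasimonotone x y i : orthant R n x -> x <=v y -> x i 0 = y i 0 ->
  f x i <= f y i.
Proof.
move=> x0 xy xyi; have [L L0 hL] := vfield_lipschitz hN; have [_ _ nullA] := hN.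
apply: (@coordwise_monotone _ _ (fun x => f x i) (fun j => j != i)) => //.
- move=> j ji; apply: (coord_monotone (ltW L0) (hL i) nullA) => z z0 nAz.
  have zO : orthant R n z by move=> l; rewrite mxE ltW.
  have [partials [offdiag _]] : [set x | has_partials (vfield N) x /\
      compartmental (gradient (vfield N) x)^T] z.
    by apply: contrapT => nz; exact: nAz.
  have [_] := dini_le_derivable (partials i j).
  by apply: dini_leW; have := offdiag _ _ ji; rewrite !mxE oppr_le0.
- by move=> j /negPn/eqP ->.
Qed.

(** The row sums of the transposed gradient are the partial derivatives of the total rate. Internal
    flows cancel in that total, so the statement says that the total outflow grows with the
    state. *)
Lemma sum_vfield_antimonotone x y : orthant R n x -> x <=v y ->
  \sum_i f y i <= \sum_i f x i.
Proof.
move=> x0 xy; have [L L0 hL] := vfield_lipschitz hN; have [_ _ nullA] := hN.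
rewrite -lerN2.
have nL0 : 0 <= n%:R * L by rewrite mulr_ge0// ltW.
have gL : lipschitz_orthant (n%:R * L) (fun x => - \sum_i f x i).
  move=> z z' zO zO'; rewrite -opprD normrN -sumrB (le_trans (ler_norm_sum _ _ _))//.
  rewrite (le_trans (ler_sum _ (fun i _ => hL i _ _ zO zO')))//.
  by rewrite sumr_const card_ord -mulrA mulr_natl.
apply: (@coordwise_monotone _ _ (fun x => - \sum_i f x i) predT) => //.
move=> j _; apply: (coord_monotone nL0 gL nullA) => z z0 nAz.
have zO : orthant R n z by move=> l; rewrite mxE ltW.
have [partials [_ colsum]] : [set x | has_partials (vfield N) x /\
    compartmental (gradient (vfield N) x)^T] z.
  by apply: contrapT => nz; exact: nAz.
have := dini_le_sum (index_enum _) (fun i => (dini_le_derivable (partials i j)).1).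
move=> /(dini_leW (k' := 0)) dsum.
apply: near_eq_dini_le (dsum _); rewrite ?opprK//.
  by apply: nearW => t; rewrite opprK.
have := colsum j; rewrite !mxE; apply: le_trans.
by rewrite le_eqVlt; apply/orP; left; apply/eqP; apply: eq_bigr => i _; rewrite !mxE mulr1.
Qed.

(* Compare both x and y with their join: the mass inequality between y and the
   join bounds the sum over all cells, and quasimonotonicity discards the cells
   outside J. *)
Lemma sum_vfieldB_le0 x y (J : pred 'I_n) : orthant R n x -> orthant R n y ->
  (forall i, J i -> y i 0 <= x i 0) -> (forall i, ~~ J i -> x i 0 <= y i 0) ->
  \sum_(i | J i) (f x i - f y i) <= 0.
Proof.
move=> x0 y0 Jyx Jxy.
pose z : 'cV[R]_n := \col_i Num.max (x i 0) (y i 0).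
have xz : x <=v z by move=> i; rewrite mxE le_max lexx.
have yz : y <=v z by move=> i; rewrite mxE le_max lexx orbT.
apply: (@le_trans _ _ (\sum_(i | J i) (f z i - f y i))).
  apply: ler_sum => i Ji; rewrite lerD2r; apply: vfield_quasimonotone => //.
  by rewrite mxE (max_idPl (Jyx i Ji)).
apply: (@le_trans _ _ (\sum_i (f z i - f y i))).
  rewrite [leRHS](bigID J)/= lerDl; apply: sumr_ge0 => i Ji.
  rewrite subr_ge0; apply: vfield_quasimonotone => //.
  by rewrite mxE (max_idPr (Jxy i Ji)).
by rewrite sumrB subr_le0; exact: sum_vfield_antimonotone.
Qed.

Lemma excess_nonincreasing (u u' x x' : R -> 'cV[R]_n) :
  inflow N u -> inflow N u' -> solution N u x -> solution N u' x' ->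
  (forall t, 0 <= t -> u t <=v u' t) ->
  forall s t, 0 <= s -> s <= t ->
    \sum_i Num.max 0 (x t i 0 - x' t i 0) <= \sum_i Num.max 0 (x s i 0 - x' s i 0).
Proof.
move=> hu hu' sx sx' uu' s t s0 st.
pose d i (r : R) := x (Num.max 0 r) i 0 - x' (Num.max 0 r) i 0.
have cd i : continuous (d i).
  move=> r; have /(_ r) c1 := @continuous_solution_coord _ _ _ _ _ i sx.
  have /(_ r) c2 := @continuous_solution_coord _ _ _ _ _ i sx'.
  exact: cvgB.
pose V r := \sum_i Num.max 0 (d i r).
have cV : continuous V.
  apply: continuous_big => [|i _ r]; first exact: add_continuous.
  exact: (@cvg_comp _ _ _ (d i) (fun s : R => Num.max 0 s) _ _ _ (cd i r)
    (@continuous_max0 R _)).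
have VE r : 0 <= r -> V r = \sum_i Num.max 0 (x r i 0 - x' r i 0).
  by move=> r0; rewrite /V/d (max_idPr r0).
suff : V t - V s <= 0 * (t - s).
  by rewrite mul0r subr_le0 !VE// (le_trans s0).
apply: dini_le_growth => // r /andP[sr rt].
have r0 : 0 <= r by exact: le_trans sr.
pose h i := f (x r) i - f (x' r) i.
(* At a tie the positive part grows at rate at most [Num.max 0 (h i)], so a tied cell joins [J]
   exactly when [h i] is nonnegative; [sum_vfieldB_le0] accepts tied cells on either side. *)
pose J i := (x' r i 0 < x r i 0) || (x' r i 0 == x r i 0) && (0 <= h i).
have dE i : d i r = x r i 0 - x' r i 0 by rewrite /d (max_idPr r0).
have di i : dini_le (fun r => Num.max 0 (d i r)) r (if J i then h i else 0).
  apply: (@dini_le_max0 _ _ _ (h i)).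
  - by have /cvg_at_right_filter := cd i r.
  - exact: (dini_le_solutionB hN i hu hu' sx sx' uu' r0).
  - rewrite dE subr_ge0 /J le_eqVlt; case: ltP => //= _; rewrite orbF => ->.
    by rewrite /=; have [//|/ltW] := leP 0 (h i).
  - by rewrite dE subr_le0 /J; case: ltP => //= _ _; case: ifP => // /andP[].
apply: dini_leW (dini_le_sum (index_enum _) di).
rewrite -big_mkcond/=; have [x0 _ _] := sx; have [x'0 _ _] := sx'.
apply: sum_vfieldB_le0; [exact: x0|exact: x'0| |].
- by move=> i /orP[/ltW//|/andP[/eqP->]].
- by move=> i; rewrite negb_or -leNgt => /andP[].
Qed.

(** Reduces contraction to two uses of [excess_nonincreasing], with the solutions in either
    order. *)
Lemma l1normE_excess x y :
  l1norm (x - y) = \sum_i Num.max 0 (x i 0 - y i 0) + \sum_i Num.max 0 (y i 0 - x i 0).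
Proof.
rewrite -big_split/=; apply: eq_bigr => i _; rewrite !mxE -(opprB (x i 0) (y i 0)).
case: (ltgtP 0 (x i 0 - y i 0)) => [d0|d0|<-]; last by rewrite oppr0 maxxx normr0 addr0.
  by rewrite gtr0_norm// (max_idPl _) ?addr0// oppr_le0 ltW.
by rewrite ltr0_norm// (max_idPr _) ?add0r// oppr_ge0 ltW.
Qed.

(** The total excess of [x] over [x'] is zero at the start and cannot grow, and it dominates every
    coordinate of [x - x']. *)
Lemma solution_le (u u' x x' : R -> 'cV[R]_n) :
  inflow N u -> inflow N u' -> solution N u x -> solution N u' x' ->
  x 0 <=v x' 0 -> (forall t, 0 <= t -> u t <=v u' t) ->
  forall t, 0 <= t -> x t <=v x' t.
Proof.
move=> hu hu' sx sx' xx' uu' t t0 i.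
have := excess_nonincreasing hu hu' sx sx' uu' (lexx 0) t0.
rewrite [leRHS]big1; last by move=> j _; apply/max_idPl; rewrite subr_le0; exact: xx'.
have max_ge0 j : 0 <= Num.max 0 (x t j 0 - x' t j 0) by rewrite le_max lexx.
move=> sum0; rewrite -subr_le0; apply: le_trans sum0.
rewrite (bigD1 i)//= (@le_trans _ _ (Num.max 0 (x t i 0 - x' t i 0)))//.
  by rewrite le_max lexx orbT.
by rewrite lerDl; apply: sumr_ge0 => j _; exact: max_ge0.
Qed.

Lemma l1norm_solutionB_nonincreasing (u x x' : R -> 'cV[R]_n) :
  inflow N u -> solution N u x -> solution N u x' ->
  forall s t, 0 <= s -> s <= t -> l1norm (x t - x' t) <= l1norm (x s - x' s).
Proof.
move=> hu sx sx' s t s0 st; rewrite !l1normE_excess.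
have uu r : 0 <= r -> u r <=v u r by move=> _ i.
by apply: lerD; [exact: (excess_nonincreasing hu hu sx sx' uu s0 st)|
                 exact: (excess_nonincreasing hu hu sx' sx uu s0 st)].
Qed.

End comparison.

(** * Existence of solutions *)

Lemma continuous_coord (R : realType) n (x : R -> 'cV[R]_n) :
  (forall i, continuous (fun t => x t i 0)) -> continuous x.
Proof.
move=> cx t; apply/cvgrPdist_le => e e0.
have near_coord i : \forall s \near t, `|x t i 0 - x s i 0| <= e.
  by have /cvgrPdist_le/(_ _ e0) := cx i t.
near=> s; apply: cV_norm_le => [|i]; first exact: ltW.
by rewrite !mxE; move: i; near: s; exact: filter_forall.
Unshelve. all: by end_near. Qed.

Lemma continuous_integral (R : realType) (g : R -> R) : continuous g ->
  continuous (fun t : R => \int[@lebesgue_measure R]_(s in `[0, t]) g s).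
Proof.
move=> cg.
have ig b : 0 < b -> {within `[0, b], continuous
    (fun t : R => \int[@lebesgue_measure R]_(s in `[0, t]) g s)}.
  move=> b0.
  exact: parameterized_integral_continuous (ltW b0) (integrable_continuous b cg).
have : {within `[0, +oo[, continuous
    (fun t : R => \int[@lebesgue_measure R]_(s in `[0, t]) g s)}.
  apply/continuous_within_itvcyP; split.
    move=> t; rewrite in_itv/= andbT => t0.
    have t1 : 0 < t + 1 by rewrite addr_gt0.
    have /(continuous_within_itvP _ t1)[+ _ _] := ig _ t1.
    by apply; rewrite in_itv/= t0 ltrDl ltr01.
  by have /(continuous_within_itvP _ ltr01)[_ + _] := ig _ ltr01.
move=> /within_continuous_max cI t.
(* At negative times both sides vanish: one integrates over the empty set, the other over a single
   point. *)
have -> : (fun t : R => \int[@lebesgue_measure R]_(s in `[0, t]) g s) =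
    (fun t : R => \int[@lebesgue_measure R]_(s in `[0, Num.max 0 t]) g s).
  apply/funext => s; have [//|s0] := leP 0 s.
  by rewrite set_itv1 Rintegral_set1 set_itv_ge ?Rintegral_set0// bnd_simp -ltNge.
exact: cI.
Qed.

Lemma dini_le_integral_continuous (R : realType) (g : R -> R) (s : R) :
  continuous g -> 0 <= s ->
  dini_le (fun t : R => \int[@lebesgue_measure R]_(r in `[0, t]) g r) s (g s) /\
  dini_le (fun t : R => - (\int[@lebesgue_measure R]_(r in `[0, t]) g r)) s (- g s).
Proof.
move=> cg s0.
have ig T := integrable_continuous T cg.
have i0 T : (@lebesgue_measure R).-integrable `[0, T] (EFin \o (fun=> 0)).
  by apply: integrable_continuous => ?; exact: cvg_cst.
split.
  have near_g (e : R) : 0 < e -> \forall r \near s^'+, g r <= 0 + (g s + e).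
    move=> e0; rewrite add0r; have /cvg_at_right_filter/cvgr_le := cg s; apply.
    by rewrite ltrDl.
  apply: near_eq_dini_le (dini_le_integral ig i0 s0 near_g).
    by rewrite Rintegral_cst// mul0r subr0.
  by apply: nearW => r; rewrite Rintegral_cst// mul0r subr0.
have near_g (e : R) : 0 < e -> \forall r \near s^'+, 0 <= g r + (- g s + e).
  move=> e0; have /cvg_at_right_filter/cvgr_ge := cg s => /(_ (g s - e)).
  by rewrite ltrBlDr ltrDl => /(_ e0); apply: filterS => r; lra.
apply: near_eq_dini_le (dini_le_integral i0 ig s0 near_g).
  by rewrite Rintegral_cst// mul0r sub0r.
by apply: nearW => r; rewrite Rintegral_cst// mul0r sub0r.
Qed.

(** A substitute for evaluating the integral of [B]: [H] need not be a primitive, only grow at least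
    at rate [B], which is the meaning of the bound on [- H]. *)
Lemma integral_le_growth (R : realType) (g B H : R -> R) (t : R) :
  continuous g -> continuous H -> 0 <= t ->
  (forall s, 0 <= s < t -> g s <= B s) ->
  (forall s, 0 <= s < t -> dini_le (fun r => - H r) s (- B s)) ->
  \int[@lebesgue_measure R]_(s in `[0, t]) g s <= H t - H 0.
Proof.
move=> cg cH t0 gB dH.
pose I (r : R) := \int[@lebesgue_measure R]_(s in `[0, r]) g s.
have cI : continuous I by exact: continuous_integral.
have dI s : 0 <= s -> dini_le I s (g s).
  by move=> s0; have [] := dini_le_integral_continuous cg s0.
have I0 : I 0 = 0 by rewrite /I set_itv1 Rintegral_set1.
pose V r := I r - H r.
have cV : continuous V by move=> r; apply: cvgB; [exact: cI|exact: cH].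
have : V t - V 0 <= 0 * (t - 0).
  apply: dini_le_growth => // s /[dup] /andP[s0 _] st.
  apply: dini_leW (dini_leD (dI s s0) (dH s st)).
  by rewrite subr_le0 gB.
by rewrite /V I0 -/(I t); lra.
Qed.

Lemma normr_integral_le_growth (R : realType) (g B H : R -> R) (t : R) :
  continuous g -> continuous H -> 0 <= t ->
  (forall s, 0 <= s < t -> `|g s| <= B s) ->
  (forall s, 0 <= s < t -> dini_le (fun r => - H r) s (- B s)) ->
  `|\int[@lebesgue_measure R]_(s in `[0, t]) g s| <= H t - H 0.
Proof.
move=> cg cH t0 gB dH; rewrite ler_norml lerNl; apply/andP; split; last first.
  by apply: integral_le_growth dH => // s st; rewrite (le_trans (ler_norm _))// gB.
have -> : - (\int[@lebesgue_measure R]_(s in `[0, t]) g s) =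
    \int[@lebesgue_measure R]_(s in `[0, t]) (- 1 * g s).
  rewrite RintegralZl// ?mulN1r//; exact: integrable_continuous.
apply: integral_le_growth dH => //.
  by move=> r; apply: cvgM; [exact: cvg_cst|exact: cg].
by move=> s st; rewrite mulN1r (le_trans (ler_norm _))// normrN gB.
Qed.

(** By convexity the exponential lies above its tangent at [s]. *)
Lemma dini_le_exp (R : realType) (A k s : R) : 0 <= A -> 0 < k ->
  dini_le (fun r => - (A / k * expR (k * r))) s (- (A * expR (k * s))).
Proof.
move=> A0 k0 e e0; near=> t.
have st : 0 <= t - s by rewrite subr_ge0 ltW//; near: t; exact: nbhs_right_gt.
have -> : k * t = k * s + k * (t - s) by lra.
rewrite expRD; set E := expR (k * s).
have E0 : 0 <= A / k * E by rewrite mulr_ge0 ?expR_ge0// divr_ge0// ltW.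
have := ler_wpM2l E0 (expR_ge1Dx (k * (t - s))).
have -> : A / k * E * (1 + k * (t - s)) = A / k * E + A * E * (t - s).
  by field; rewrite gt_eqF.
have : 0 <= e * (t - s) by rewrite mulr_ge0// ltW.
rewrite -!mulrA; lra.
Unshelve. all: by end_near. Qed.

(** The intervals of centre [a k] and radius [2 * C / 2 ^+ k] are nested, and the supremum of their
    left ends lies in all of them. *)
Lemma geometric_limit (R : realType) (a : nat -> R) (C : R) :
  (forall k, `|a k.+1 - a k| <= C / 2 ^+ k) ->
  exists l, forall k, `|l - a k| <= 2 * C / 2 ^+ k.
Proof.
move=> aC; pose b k := a k - 2 * C / 2 ^+ k; pose c k := a k + 2 * C / 2 ^+ k.
have half k : 2 * C / 2 ^+ k.+1 = C / 2 ^+ k.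
  by rewrite exprS; field; rewrite expf_neq0// pnatr_eq0.
have dbl k : 2 * C / 2 ^+ k = C / 2 ^+ k + C / 2 ^+ k by lra.
have b_le : {homo b : k m / (k <= m)%N >-> k <= m}.
  apply: (@homo_leq _ b <=%O) => [//||k]; first exact: le_trans.
  have := aC k; rewrite /b half dbl ler_norml => /andP[]; lra.
have c_ge : {homo c : k m / (k <= m)%N >-> m <= k}.
  apply: (@homo_leq _ c (fun x y => y <= x)) => [//||k].
    by move=> x y z xy yz; exact: le_trans yz xy.
  have := aC k; rewrite /c half dbl ler_norml => /andP[]; lra.
have C0 k : 0 <= 2 * C / 2 ^+ k.
  by rewrite dbl addr_ge0// (le_trans _ (aC k)).
have bc k m : b k <= c m.
  apply: le_trans (b_le _ _ (leq_maxl k m)) _.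
  apply: le_trans (c_ge _ _ (leq_maxr k m)).
  by rewrite /b /c; have := C0 (maxn k m); lra.
have ub : has_ubound (range b) by exists (c 0%N) => _ [k _ <-].
exists (sup (range b)) => k.
have h1 : b k <= sup (range b) by apply: ub_le_sup => //; exists k.
have h2 : sup (range b) <= c k.
  by apply: ge_sup; [exists (b 0%N), 0%N|move=> _ [m _ <-]].
by rewrite ler_norml; move: h1 h2; rewrite /b /c => ? ?; apply/andP; split; lra.
Qed.

Lemma le0_geometric (R : realType) (x C : R) :
  (forall k : nat, x <= C / 2 ^+ k) -> x <= 0.
Proof.
move=> xC; rewrite leNgt; apply/negP => x0.
have C0 : 0 < C by rewrite (lt_le_trans x0)//; have := xC 0%N; rewrite expr0 divr1.
have Cx : 0 <= C / x by rewrite divr_ge0// ltW.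
have := archi_boundP Cx; set k := Num.bound _ => Ck.
have := xC k; rewrite ler_pdivlMr ?exprn_gt0// leNgt => /negP; apply.
rewrite mulrC -ltr_pdivrMr//; apply: lt_trans Ck _.
by rewrite -natrX ltr_nat ltn_expl.
Qed.

Lemma dini_le_shift (R : realType) (V : R -> R) (s h k : R) :
  dini_le V (s + h) k -> dini_le (fun t => V (t + h)) s k.
Proof.
move=> dV e e0; have [d /= d0 hd] := dV e e0.
exists d => //= t td st.
have sh : s + h - (t + h) = s - t by lra.
have th : t + h - (s + h) = t - s by lra.
by have := hd (t + h); rewrite /= sh th ltrD2r; apply.
Qed.

(** The shifted primitive grows exactly at rate [g (s + h)], so [integral_le_growth] for [g] and for
    its opposite gives the two inequalities, without a change of variables. *)
Lemma integral_shift (R : realType) (g : R -> R) (h t : R) :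
  continuous g -> 0 <= h -> 0 <= t ->
  \int[@lebesgue_measure R]_(s in `[0, t]) g (s + h) =
  \int[@lebesgue_measure R]_(s in `[0, t + h]) g s -
  \int[@lebesgue_measure R]_(s in `[0, h]) g s.
Proof.
move=> cg h0 t0.
have cS (f : R -> R) : continuous f -> continuous (fun s => f (s + h)).
  move=> cf s; apply: (@cvg_comp _ _ _ (fun s => s + h) f); last exact: cf.
  by apply: cvgD; [exact: cvg_id|exact: cvg_cst].
pose I t := \int[@lebesgue_measure R]_(s in `[0, t]) g s.
have cI : continuous (fun s => I (s + h)).
  by apply: (cS I); exact: continuous_integral.
have cNI : continuous (fun s => - I (s + h)) by move=> s; apply: cvgN; exact: cI.
have dI s : 0 <= s -> dini_le (fun r => I (r + h)) s (g (s + h)) /\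
    dini_le (fun r => - I (r + h)) s (- g (s + h)).
  move=> s0; have sh0 : 0 <= s + h by exact: addr_ge0.
  have [d1 d2] := dini_le_integral_continuous cg sh0.
  by split; [exact: (dini_le_shift (V := I))|
             exact: (dini_le_shift (V := fun r => - I r))].
have IhE : I (0 + h) = I h by rewrite add0r.
apply/eqP; rewrite eq_le; apply/andP; split.
  rewrite -/(I (t + h)) -/(I h) -IhE.
  apply: (@integral_le_growth _ _ (fun s => g (s + h)) (fun s => I (s + h))) => //.
    exact: cS.
  by move=> s /andP[s0 _]; have [] := dI s s0.
rewrite -lerN2 -/(I (t + h)) -/(I h) -IhE opprB addrC.
have -> : - (\int[@lebesgue_measure R]_(s in `[0, t]) g (s + h)) =
    \int[@lebesgue_measure R]_(s in `[0, t]) (- 1 * g (s + h)).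
  by rewrite RintegralZl// ?mulN1r//; apply: integrable_continuous; exact: cS.
rewrite -[X in _ + X](opprK (I (0 + h))).
apply: (@integral_le_growth _ _ (fun s => - 1 * g (s + h)) (fun s => - I (s + h))) => //.
  by move=> s; apply: cvgM; [exact: cvg_cst|exact: cS].
move=> s /andP[s0 _]; rewrite mulN1r opprK; apply: near_eq_dini_le (dI s s0).1.
  by rewrite opprK.
by apply: nearW => r; rewrite opprK.
Qed.

(** * Picard iteration with an exponential weight *)

Section picard.
Context (R : realType) (n : nat) (G : 'I_n -> 'cV[R]_n -> R) (L : R) (q : 'cV[R]_n).
Hypothesis L0 : 0 < L.
Hypothesis GL : forall i x y, `|G i x - G i y| <= L * `|x - y|.
Local Notation integral g t := (\int[@lebesgue_measure R]_(s in `[0, t]) g s).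

Fixpoint picard (k : nat) (t : R) : 'cV[R]_n :=
  if k is k'.+1 then \col_i (q i 0 + integral (fun s => G i (picard k' s)) t)
  else q.

Lemma continuous_comp_lipschitz (y : R -> 'cV[R]_n) i :
  continuous y -> continuous (fun t => G i (y t)).
Proof.
move=> cy t; apply/cvgrPdist_lt => e e0.
have eL : 0 < e / L by rewrite divr_gt0.
have := cy t; move/cvgrPdist_lt/(_ _ eL); apply: filterS => s ys.
by apply: le_lt_trans (GL _ _ _) _; rewrite mulrC -ltr_pdivlMr.
Qed.

Lemma continuous_picard k : continuous (picard k).
Proof.
elim: k => [|k IH] /=; first by move=> t; exact: cvg_cst.
apply: continuous_coord => i.
have -> : (fun t => picard k.+1 t i 0) =
    (fun t => q i 0 + integral (fun s => G i (picard k s)) t).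
  by apply/funext => t; rewrite mxE.
move=> t; apply: cvgD; first exact: cvg_cst.
have := continuous_integral (@continuous_comp_lipschitz _ i IH).
by move=> /(_ t).
Qed.

Lemma integralB (g h : R -> R) t : continuous g -> continuous h ->
  integral g t - integral h t = integral (fun s => g s - h s) t.
Proof. by move=> cg ch; rewrite RintegralB//; exact: integrable_continuous. Qed.

(** [C] bounds the field at the initial point, and [M * expR (2 * L * t)] is a primitive of
    [C * expR (2 * L * t)]. Measured against the weight [E] (Bielecki's norm), each iteration halves
    the distance on the whole half-line, so no continuation of local solutions is required. *)
Let C := \sum_i `|G i q|.
Let M := C / (2 * L).
Let E (t : R) := expR (2 * L * Num.max 0 t).

Let C0 : 0 <= C. Proof. exact: sumr_ge0. Qed.
Let M0 : 0 <= M. Proof. by rewrite divr_ge0// mulr_ge0// ltW. Qed.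
Let L20 : 0 < 2 * L. Proof. by rewrite mulr_gt0. Qed.

Let picard_neg k t : t < 0 -> picard k t = q.
Proof.
move=> t0; case: k => [//|k]; apply/colP => i /=; rewrite !mxE.
by rewrite set_itv_ge ?Rintegral_set0 ?addr0// bnd_simp -ltNge.
Qed.

Lemma continuous_expR_scale (A k : R) : continuous (fun r => A * expR (k * r)).
Proof.
move=> r; apply: cvgM; first exact: cvg_cst.
apply: (@cvg_comp _ _ _ (fun r => k * r) expR); last exact: continuous_expR.
by apply: cvgM; [exact: cvg_cst|exact: cvg_id].
Qed.

Lemma picard_dist k t : `|picard k.+1 t - picard k t| <= M * E t / 2 ^+ k.
Proof.
have EM0 k' s : 0 <= M * E s / 2 ^+ k'.
  by rewrite divr_ge0 ?exprn_ge0// mulr_ge0// expR_ge0.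
have [t0|t0] := ltP t 0.
  by rewrite !picard_neg// subrr normr0.
elim: k t t0 => [|k IH] t t0; apply: cV_norm_le => // i; rewrite [picard]lock !mxE -lock.
  rewrite expr0 divr1 /= mxE addrAC subrr add0r.
  apply: le_trans (_ : M * expR (2 * L * t) - M * expR (2 * L * 0) <= _); last first.
    by rewrite /E (max_idPr t0) gerBl mulr_ge0// expR_ge0.
  apply: (@normr_integral_le_growth _ _ (fun s => C * expR (2 * L * s))
    (fun s => M * expR (2 * L * s))) => //.
  - by move=> ?; exact: cvg_cst.
  - exact: continuous_expR_scale.
  - move=> s /andP[s0 _]; apply: (@le_trans _ _ C).
      by rewrite /C (bigD1 i)//= lerDl sumr_ge0.
    have E1 : 1 <= expR (2 * L * s) by rewrite -[leLHS]expR0 ler_expR mulr_ge0// ltW.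
    by rewrite ler_peMr.
  - by move=> s _; exact: dini_le_exp.
rewrite /= !mxE [X in `|X|](_ : _ = integral (fun s => G i (picard k.+1 s)) t -
                integral (fun s => G i (picard k s)) t); last by rewrite /=; lra.
rewrite integralB; try exact: continuous_comp_lipschitz (@continuous_picard _).
(* A primitive of [L * expR (2 * L * s)] is half of [expR (2 * L * s)], which accounts for the extra
   factor 1/2. *)
set B := M / 2 ^+ k.+1.
have BE : M / 2 ^+ k * L = B * (2 * L).
  by rewrite /B exprS; field; rewrite expf_neq0// pnatr_eq0.
apply: le_trans (_ : B * expR (2 * L * t) - B * expR (2 * L * 0) <= _); last first.
  rewrite /E (max_idPr t0) mulrAC gerBl mulr_ge0// ?expR_ge0//.
  by rewrite divr_ge0// exprn_ge0.
have B0 : 0 <= B by rewrite divr_ge0// exprn_ge0.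
have A0 : 0 <= B * (2 * L) by rewrite mulr_ge0// ltW.
apply: (@normr_integral_le_growth _ _ (fun s => B * (2 * L) * expR (2 * L * s))
    (fun s => B * expR (2 * L * s))) => //.
- move=> r; apply: cvgB;
    exact: continuous_comp_lipschitz (@continuous_picard _) _.
- exact: continuous_expR_scale.
- move=> s /andP[s0 _]; apply: le_trans (GL _ _ _) _.
  rewrite -BE; have := ler_wpM2l (ltW L0) (IH s s0).
  by rewrite /E (max_idPr s0); congr (_ <= _); ring.
- move=> s _; have := @dini_le_exp R (B * (2 * L)) (2 * L) s A0 L20.
  by rewrite mulfK// gt_eqF.
Qed.

Lemma ode_solution : exists y : R -> 'cV[R]_n, continuous y /\
  forall t i, y t i 0 = q i 0 + integral (fun s => G i (y s)) t.
Proof.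
have lim_exists (ti : R * 'I_n) : exists l : R, forall k,
    `|l - picard k ti.1 ti.2 0| <= 2 * (M * E ti.1) / 2 ^+ k.
  apply: geometric_limit => k; apply: le_trans (picard_dist k ti.1).
  by have := coord_le_norm (picard k.+1 ti.1 - picard k ti.1) ti.2; rewrite [picard]lock !mxE -lock.
have [l lP] := choice lim_exists.
pose y t : 'cV[R]_n := \col_i l (t, i).
have yP k t : `|y t - picard k t| <= 2 * (M * E t) / 2 ^+ k.
  apply: cV_norm_le => [|i].
    by rewrite divr_ge0 ?exprn_ge0// mulr_ge0// mulr_ge0// expR_ge0.
  by have := lP (t, i) k; rewrite [picard]lock !mxE -lock.
have E_mono s t : s <= t -> E s <= E t.
  by move=> st; rewrite /E ler_expR (ler_wpM2l (ltW L20))// ge_max !le_max lexx st orbT.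
have cy : continuous y.
  move=> t; apply/cvgrPdist_le => e e0.
  (* [E] is monotone, so [K] bounds the error for all times up to [t + 1]: convergence is uniform
     near [t] and the limit inherits continuity. *)
  pose K := 2 * (M * E (t + 1)).
  have [k Kk] : exists k : nat, K / 2 ^+ k < e / 3.
    apply: contrapT => nk.
    suff : e / 3 <= 0 by rewrite leNgt divr_gt0.
    apply: (@le0_geometric _ _ K) => k; rewrite leNgt; apply/negP => Kk.
    by apply: nk; exists k.
  have e30 : 0 < e / 3 by rewrite divr_gt0.
  have yK s : s <= t + 1 -> `|y s - picard k s| <= e / 3.
    move=> st; apply: le_trans (yP k s) _; apply: le_trans (ltW Kk).
    rewrite ler_wpM2r ?invr_ge0 ?exprn_ge0// /K ler_wpM2l// ler_wpM2l//.
    exact: E_mono.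
  have := @continuous_picard k t; move/cvgrPdist_le => /(_ _ e30) cp.
  near=> s.
  have s1 : s <= t + 1.
    have : `|t - s| < 1 by near: s; apply: cvgr_dist_lt => //; exact: cvg_id.
    by rewrite ltr_norml => /andP[]; lra.
  have t1 : t <= t + 1 by rewrite lerDl.
  have d1 := yK t t1; have d2 := yK s s1.
  have d3 : `|picard k t - picard k s| <= e / 3 by near: s.
  apply: le_trans (ler_distD (picard k t) _ _) _.
  apply: le_trans (lerD (lexx _) (ler_distD (picard k s) _ _)) _.
  by rewrite (distrC _ (y s)); lra.
exists y; split => // t i.
have [t0|t0] := ltP t 0.
  have yq : y t = q.
    apply/eqP; rewrite -subr_eq0 -normr_le0; apply: (@le0_geometric _ _ (2 * (M * E t))) => k.
    by rewrite -(picard_neg k t0).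
  by rewrite yq set_itv_ge ?Rintegral_set0 ?addr0// bnd_simp -ltNge.
apply/eqP; rewrite -subr_eq0 -normr_le0.
pose K := 2 * (M * E t).
have K0 : 0 <= K by rewrite mulr_ge0// mulr_ge0// expR_ge0.
(* The defect is at most [K / 2 ^+ k], from replacing [y] by iterate [k.+1], plus
   [L * K * t / 2 ^+ k], from replacing it by iterate [k] under the integral. *)
apply: (@le0_geometric _ _ (K + L * K * t)) => k.
have cG := continuous_comp_lipschitz (i := i) cy.
have cGk := continuous_comp_lipschitz (i := i) (@continuous_picard k).
have int_dist : `|integral (fun s => G i (picard k s)) t - integral (fun s => G i (y s)) t|
    <= L * K / 2 ^+ k * t.
  rewrite integralB//.
  rewrite -[leRHS]subr0 -[X in _ - X](mulr0 (L * K / 2 ^+ k)).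
  apply: (@normr_integral_le_growth _ _ (fun=> L * K / 2 ^+ k)
    (fun s => L * K / 2 ^+ k * s)) => //.
  - by move=> r; apply: cvgB; [exact: cGk|exact: cG].
  - by move=> r; apply: cvgM; [exact: cvg_cst|exact: cvg_id].
  - move=> s /andP[s0 st]; apply: le_trans (GL _ _ _) _.
    rewrite -(mulrA L K) ler_wpM2l ?(ltW L0)// distrC (le_trans (yP k s))//.
    rewrite /K ler_wpM2r ?invr_ge0 ?exprn_ge0// ler_wpM2l// ler_wpM2l//.
    by apply: E_mono; exact: ltW.
  - move=> s _ e e0; near=> r.
    have sr : 0 <= r - s by rewrite subr_ge0 ltW//; near: r; exact: nbhs_right_gt.
    have : 0 <= e * (r - s) by rewrite mulr_ge0// ltW.
    by lra.
have yk : `|y t i 0 - picard k.+1 t i 0| <= K / 2 ^+ k.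
  apply: le_trans (_ : K / 2 ^+ k.+1 <= _).
    have := coord_le_norm (y t - picard k.+1 t) i.
    by rewrite [picard]lock mxE [X in _ + X]mxE -lock => /le_trans; apply; exact: yP.
  rewrite ler_wpM2l// lef_pV2 ?posrE ?exprn_gt0// ler_eXn2l ?ltr1n//.
rewrite /= mxE in yk.
apply: le_trans (ler_distD (q i 0 + integral (fun s => G i (picard k s)) t) _ _) _.
rewrite [X in _ + `|X| <= _](_ : _ = integral (fun s => G i (picard k s)) t -
  integral (fun s => G i (y s)) t); last by rewrite opprD addrACA subrr add0r.
by rewrite (le_trans (lerD yk int_dist))// mulrDl [L * K * t / _]mulrAC.
Unshelve. all: by end_near. Qed.

End picard.

(** * Solutions and equilibria under constant inflow *)

Section constant_inflow.
Context (R : realType) (n : nat) (N : flow_network R n).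
Hypothesis hN : monotone_network N.
Local Notation f x i := (vfield N x i 0).

Definition pos_part (x : 'cV[R]_n) : 'cV[R]_n := \col_i Num.max 0 (x i 0).

Lemma pos_part_orthant x : orthant R n (pos_part x).
Proof. by move=> i; rewrite !mxE le_max lexx. Qed.

Lemma pos_part_id x : orthant R n x -> pos_part x = x.
Proof.
move=> x0; apply/colP => i; rewrite mxE; apply/max_idPr.
by have := x0 i; rewrite mxE.
Qed.

(** An empty cell loses nothing, so only its nonnegative incoming flows remain. *)
Lemma vfield_ge0_empty x i : orthant R n x -> x i 0 = 0 -> 0 <= f x i.
Proof.
move=> x0 xi0; rewrite vfieldE -addrA -opprD (addrC (\sum_j flow N x i j)).
rewrite (@flow_empty R n N x x0 i xi0) subr0.
by apply: sumr_ge0 => j _; exact: (@flow_ge0 R n N x x0).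
Qed.

Lemma inflow_cst u : admissible N u -> inflow N (cst u).
Proof.
move=> hu; split => // T i.
by apply: integrable_continuous => ?; exact: cvg_cst.
Qed.

(* The field extended to the whole space through pos_part is globally
   Lipschitz, and it points inwards wherever a coordinate is nonpositive. *)
Lemma solution_exists u q : admissible N u -> orthant R n q ->
  exists2 x, solution N (cst u) x & x 0 = q.
Proof.
move=> [u0 _] q0; have [L L0 hL] := vfield_lipschitz hN.
pose G i y := u i 0 + f (pos_part y) i.
have GL i x y : `|G i x - G i y| <= L * `|x - y|.
  rewrite /G opprD addrACA subrr add0r (le_trans (hL i _ _ (pos_part_orthant x) (pos_part_orthant y)))//.
  apply: ler_wpM2l; first exact: ltW.
  apply: cV_norm_le => // j; rewrite !mxE.
  rewrite (le_trans (lipschitz_max0 _ _))//.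
  by have := coord_le_norm (x - y) j; rewrite !mxE.
have [y [cy yE]] := ode_solution q L0 GL.
have y00 : y 0 = q.
  by apply/colP => i; rewrite yE set_itv1 Rintegral_set1 addr0.
have cyi i : continuous (fun t => y t i 0).
  move=> t; apply: (@cvg_comp _ _ _ y (fun M => M i 0) _ _ _ (cy t)).
  exact: coord_continuous.
have y_ge0 t : 0 <= t -> orthant R n (y t).
  move=> t0 i; rewrite mxE.
  pose V s := Num.max 0 (- y s i 0).
  have cV : continuous V.
    move=> s; apply: (@cvg_comp _ _ _ (fun s => - y s i 0) (fun s : R => Num.max 0 s)).
      by apply: cvgN; exact: cyi.
    exact: continuous_max0.
  have : V t - V 0 <= 0 * (t - 0).
    apply: dini_le_growth => // s /andP[s0 _].
    apply: (@dini_le_max0 _ _ _ (- G i (y s))).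
    - by apply: cvg_at_right_filter; apply: cvgN; exact: cyi.
    - have cG := continuous_comp_lipschitz L0 GL (i := i) cy.
      have [_ dI] := dini_le_integral_continuous cG s0.
      rewrite -[- G i _]add0r.
      apply: near_eq_dini_le (dini_leD (dini_le_cst (- q i 0) s) dI).
        by rewrite yE opprD.
      by apply: nearW => r; rewrite [in RHS]yE opprD.
    (* When [y s i 0 <= 0], cell [i] of [pos_part (y s)] is empty. *)
    - rewrite oppr_ge0 oppr_le0 => ys; rewrite addr_ge0//; first by have := u0 i; rewrite mxE.
      apply: vfield_ge0_empty; first exact: pos_part_orthant.
      by rewrite mxE; apply/max_idPl.
    - by [].
  rewrite mul0r subr_le0 /V y00 (_ : Num.max 0 (- q i 0) = 0).
    by rewrite ge_max lexx/= oppr_le0.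
  by apply/max_idPl; rewrite oppr_le0; have := q0 i; rewrite mxE.
exists y; last exact: y00.
split; [exact: y_ge0|exact: continuous_subspaceT|].
move=> t t0 i; rewrite yE y00; congr (_ + _); apply: eq_Rintegral => s.
rewrite inE/= in_itv/= => /andP[s0 _].
by rewrite /G pos_part_id//; exact: y_ge0.
Qed.

Lemma equilibrium_solution u xs : equilibrium N u xs -> solution N (cst u) (cst xs).
Proof.
move=> [xs0 uxs]; split => //.
  by apply: continuous_subspaceT => ?; exact: cvg_cst.
move=> t t0 i; rewrite -[LHS]addr0; congr (_ + _).
have -> : (fun s : R => cst u s i 0 + f (cst xs s) i) = fun=> 0.
  by apply/funext => s; have /colP/(_ i) := uxs; rewrite !mxE.
by rewrite Rintegral_cst// mul0r.
Qed.

Lemma solution_shift u x (h : R) : 0 <= h ->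
  solution N (cst u) x -> solution N (cst u) (fun t => x (t + h)).
Proof.
move=> h0 sx; have [x0 cx xE] := sx.
split.
- by move=> t t0; apply: x0; exact: addr_ge0.
- apply/subspace_continuousP => t /=; rewrite in_itv/= andbT => t0.
  have /(_ (t + h)) cxt := within_continuous_max cx.
  rewrite /continuous_at (max_idPr (addr_ge0 t0 h0)) in cxt.
  have ch : s + h @[s --> within `[0, +oo[ (nbhs t)] --> t + h.
    apply: cvg_within_filter.
    by apply: cvgD; [exact: cvg_id|exact: cvg_cst].
  have := cvg_comp _ _ ch cxt; apply: cvg_trans; apply: near_eq_cvg.
  rewrite near_withinE; apply: nearW => s /=; rewrite in_itv/= andbT => s0.
  by rewrite (max_idPr (addr_ge0 s0 h0)).
- move=> t t0 i; have th0 := addr_ge0 t0 h0.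
  pose g (s : R) := u i 0 + f (x (Num.max 0 s)) i.
  have cg : continuous g.
    move=> s; have /(_ s) cv := @continuous_vfield_solution _ _ _ hN _ _ i sx.
    by apply: cvgD; [exact: cvg_cst|exact: cv].
  have gE r : 0 <= r -> x r i 0 = x 0 i 0 + \int[@lebesgue_measure R]_(s in `[0, r]) g s.
    move=> r0; rewrite (xE r r0); congr (_ + _); apply: eq_Rintegral => s.
    by rewrite inE/= in_itv/= => /andP[s0 _]; rewrite /g (max_idPr s0).
  rewrite add0r (gE (t + h) th0) (gE h h0).
  have -> : \int[@lebesgue_measure R]_(s in `[0, t]) (cst u s i 0 + f (x (s + h)) i) =
      \int[@lebesgue_measure R]_(s in `[0, t]) g (s + h).
    apply: eq_Rintegral => s; rewrite inE/= in_itv/= => /andP[s0 _].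
    by rewrite /g (max_idPr (addr_ge0 s0 h0)).
  by rewrite (integral_shift cg h0 t0) -addrA subrKC.
Qed.

Lemma stable_equilibrium u xs : admissible N u -> equilibrium N u xs -> stable N u xs.
Proof.
move=> hu eqx e e0; have n0 : 0 < n%:R + 1 :> R by rewrite ltr_wpDl.
(* Passing from the maximum norm to the l1-norm costs a factor [n]; [n + 1] keeps the divisor
   positive when [n = 0]. *)
exists (e / (n%:R + 1)); first exact: divr_gt0.
move=> x sx x0 t t0.
apply: le_lt_trans (norm_le_l1norm _) _.
have := l1norm_solutionB_nonincreasing hN (inflow_cst hu) sx (equilibrium_solution eqx)
  (lexx 0) t0.
move=> /le_lt_trans; apply; apply: le_lt_trans (l1norm_le_norm _) _.
rewrite ltr_pdivlMr// mulrDr mulr1 mulrC in x0.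
by apply: le_lt_trans x0; rewrite lerDl.
Qed.

(** The solution is compared with its own shift by [t - s], which starts in the orthant and hence
    above 0. *)
Lemma solution_from0_nondecreasing u x : admissible N u -> solution N (cst u) x ->
  x 0 = 0 -> forall s t, 0 <= s -> s <= t -> x s <=v x t.
Proof.
move=> hu sx x00 s t s0 st.
have ts0 : 0 <= t - s by rewrite subr_ge0.
have := solution_le hN (inflow_cst hu) (inflow_cst hu) sx (solution_shift ts0 sx) _ _ s0.
rewrite subrKC; apply; last by move=> r _ i.
by rewrite x00 add0r; have [x0 _ _] := sx; exact: x0.
Qed.

Lemma nondecreasing_ex_limit (g : R -> R) :
  (forall s t, 0 <= s -> s <= t -> g s <= g t) ->
  exists l : \bar R, (g t)%:E @[t --> +oo] --> l.
Proof.
move=> gmono; pose G t := (g (Num.max 0 t))%:E.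
have Gmono : {homo G : s t / s <= t >-> (s <= t)%E}.
  move=> s t st; rewrite lee_fin; apply: gmono; first by rewrite le_max lexx.
  by rewrite ge_max !le_max lexx st orbT.
exists (ereal_sup (range G)).
apply: cvg_trans (nondecreasing_cvge Gmono); apply: near_eq_cvg.
exists 0; split => // t t0; by rewrite /G (max_idPr (ltW t0)).
Qed.

End constant_inflow.

(** * Outflow-connected matrices *)

Section outflow_connected_weight.
Context (R : realType) (n : nat) (M : 'M[R]_n).
Hypothesis metzlerM : metzler M.

Let strict (p : 'cV[R]_n) : {set 'I_n} := [set i | (M *m p) i 0 < 0]%SET.

(* Lowering the weights of the strict rows by a small amount keeps these rows
   strict and makes strict every row with a link into them. *)
Lemma strict_rows_grow (p : 'cV[R]_n) (i j : 'I_n) :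
  (forall i, 0 < p i 0) -> (forall i, (M *m p) i 0 <= 0) ->
  i \notin strict p -> j \in strict p -> 0 < M i j ->
  exists p' : 'cV[R]_n, [/\ forall i, 0 < p' i 0, forall i, (M *m p') i 0 <= 0 &
    strict p \proper strict p'].
Proof.
move=> p0 Mp0 iNs js Mij.
pose v : 'cV[R]_n := \col_l (l \in strict p)%:R.
have Mv e k : (M *m (p - e *: v)) k 0 = (M *m p) k 0 - e * (M *m v) k 0.
  by rewrite mulmxBr -scalemxAr !mxE.
have Mv_ge0 k : k \notin strict p -> 0 <= (M *m v) k 0.
  move=> kNs; rewrite mxE; apply: sumr_ge0 => l _; rewrite mxE.
  case: (boolP (l \in strict p)) => [ls|_]; last by rewrite mulr0.
  by rewrite mulr1 metzlerM//; apply: contraNneq kNs => ->.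
have small_e : \forall e \near (0 : R)^'+, forall k,
    (0 < p k 0 - e * v k 0) /\ (k \in strict p -> (M *m p) k 0 - e * (M *m v) k 0 < 0).
  apply: filter_forall => k; apply: filterI.
    have : p k 0 - e * v k 0 @[e --> 0] --> p k 0 - 0 * v k 0.
      by apply: cvgB; [exact: cvg_cst|apply: cvgM; [exact: cvg_id|exact: cvg_cst]].
    rewrite mul0r subr0 => /cvg_at_right_filter/cvgr_gt; apply; exact: p0.
  have : (M *m p) k 0 - e * (M *m v) k 0 @[e --> 0] --> (M *m p) k 0 - 0 * (M *m v) k 0.
    by apply: cvgB; [exact: cvg_cst|apply: cvgM; [exact: cvg_id|exact: cvg_cst]].
  rewrite mul0r subr0 => /cvg_at_right_filter/cvgr_lt cMp.
  have [ks|] := boolP (k \in strict p); last by move=> _; apply: nearW.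
  by apply: filterS (cMp 0 _) => //; move: ks; rewrite inE.
have [e [e0 he]] : exists e : R, 0 < e /\ forall k,
    (0 < p k 0 - e * v k 0) /\ (k \in strict p -> (M *m p) k 0 - e * (M *m v) k 0 < 0).
  by apply: (@filter_ex _ (0 : R)^'+); apply: filterI => //; exact: nbhs_right_gt.
exists (p - e *: v); split.
- by move=> k; rewrite !mxE; have [] := he k; rewrite mxE.
- move=> k; rewrite Mv; have [ks|kNs] := boolP (k \in strict p).
    by apply: ltW; have [_ ->] := he k.
  by have := Mp0 k; have := mulr_ge0 (ltW e0) (Mv_ge0 k kNs); lra.
- apply/properP; split.
    by apply/fintype.subsetP => k ks; rewrite inE Mv; have [_ ->] := he k.
  exists i => //; rewrite inE Mv.
  have Mvi : 0 < (M *m v) i 0.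
    rewrite mxE (bigD1 j)//= mxE js mulr1 ltr_wpDr//.
    apply: sumr_ge0 => l _; rewrite mxE.
    case: (boolP (l \in strict p)) => [ls|_]; last by rewrite mulr0.
    by rewrite mulr1 metzlerM//; apply: contraNneq iNs => ->.
  by have := Mp0 i; have := mulr_gt0 e0 Mvi; lra.
Qed.

(** Starting from the all-one weights, whose strict rows are the sinks, strictness is propagated
    backwards along links until it reaches every row. *)
Lemma outflow_connected_weight : M *m ones <=v 0 -> outflow_connected M ->
  exists p : 'cV[R]_n, (forall i, 0 < p i 0) /\ (forall i, (M *m p) i 0 < 0).
Proof.
move=> M1 connM.
have M1' i : (M *m ones) i 0 <= 0 by have := M1 i; rewrite [X in _ <= X]mxE.
suff grow (m : nat) : exists p : 'cV[R]_n,
    [/\ forall i, 0 < p i 0, forall i, (M *m p) i 0 <= 0,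
        strict ones \subset strict p & (strict p == [set: 'I_n]%SET) || (m <= #|strict p|)%N].
  (* A set of [n.+1] rows is impossible, so all rows are strict. *)
  have [p [p0 Mp0 _ /orP[/eqP sT|]]] := grow n.+1.
    by exists p; split => // i; have : i \in strict p by [rewrite sT inE]; rewrite inE.
  by rewrite ltnNge -[X in (_ <= X)%N]card_ord max_card.
elim: m => [|m [p [p0 Mp0 sub /orP[sT|mp]]]].
- by exists ones; split => // [i|]; [rewrite mxE|rewrite leq0n orbT].
- by exists p; split => //; rewrite sT.
have [sT|/eqP sNT] := boolP (strict p == [set: 'I_n]%SET); first by exists p; split => //; rewrite sT.
have [i [j [iNs js Mij]]] : exists i j, [/\ i \notin strict p, j \in strict p & 0 < M i j].
  apply: contrapT => noedge; apply: sNT; apply/setP => i; rewrite [RHS]inE.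
  have into l : l \in strict ones -> l \in strict p by exact: (fintype.subsetP sub).
  case: (connM i) => [/into//|[j js]].
  move=> /connectP[s + def_j]; move: js; rewrite {}def_j => /into.
  (* Going back from the sink along the path: if [k] is strict and [i] is not, then the link from
     [i] to [k] is the one sought. *)
  elim: s i => [//|k s IH] i /= lasts /andP[/andP[_ Mik] ps].
  have ks := IH k lasts ps.
  by apply: contrapT => iNs; apply: noedge; exists i, k; split => //; exact/negP.
have [p' [p'0 Mp'0 prop]] := strict_rows_grow p0 Mp0 iNs js Mij.
exists p'; split => //; first exact: fintype.subset_trans sub (proper_sub prop).
by rewrite (leq_trans _ (proper_card prop)) ?orbT.
Qed.

End outflow_connected_weight.

(** Here [s] is a sign vector of [z] and [h] a rate, linear in [z] up to an error. Off the diagonal,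
    signs can only lower the nonnegative entries' contribution; on it, [s i 0 * z i 0] is exactly
    the absolute value. Exchanging the sums then brings out [G^T *m p]. *)
Lemma weighted_decay (R : realType) n (G : 'M[R]_n) (p z h s : 'cV[R]_n) (c e : R) :
  metzler G^T -> (forall i, 0 < p i 0) -> (forall i, (G^T *m p) i 0 <= - c) ->
  (forall i, `|h i 0 - (G *m z) i 0| <= e * l1norm z) ->
  (forall i, `|s i 0| <= 1) -> (forall i, s i 0 * z i 0 = `|z i 0|) ->
  \sum_i p i 0 * (s i 0 * h i 0) <= (e * (\sum_i p i 0) - c) * l1norm z.
Proof.
move=> metzlerG p0 Gp hz s1 sz.
have step i : s i 0 * h i 0 <= \sum_j G i j * `|z j 0| + e * l1norm z.
  have -> : s i 0 * h i 0 = s i 0 * (G *m z) i 0 + s i 0 * (h i 0 - (G *m z) i 0).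
    by rewrite mulrBr addrC subrK.
  apply: lerD.
    rewrite mxE mulr_sumr; apply: ler_sum => j _; rewrite mulrCA.
    have [<-|ij] := eqVneq i j; first by rewrite sz.
    apply: ler_wpM2l; first by have := metzlerG j i; rewrite mxE eq_sym; apply.
    by rewrite (le_trans (ler_norm _))// normrM ler_piMl.
  rewrite (le_trans (ler_norm _))// normrM (le_trans _ (hz i))//.
  by rewrite ler_piMl.
apply: (@le_trans _ _ (\sum_i p i 0 * (\sum_j G i j * `|z j 0| + e * l1norm z))).
  by apply: ler_sum => i _; rewrite ler_wpM2l// ltW.
under eq_bigr do rewrite mulrDr.
rewrite big_split/= -mulr_suml mulrBl addrC lerD//; first by rewrite mulrCA mulrA.
under eq_bigr do rewrite mulr_sumr.
rewrite exchange_big/= -mulNr /l1norm mulr_sumr; apply: ler_sum => j _.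
apply: le_trans (ler_wpM2r (normr_ge0 _) (Gp j)).
rewrite mxE mulr_suml; apply: ler_sum => i _.
by rewrite mxE mulrA (mulrC (p i 0)).
Qed.

(** * Attraction *)

Lemma cVBE (V : zmodType) n (x y : 'cV[V]_n) i : (x - y) i 0 = x i 0 - y i 0.
Proof. by rewrite !mxE. Qed.

Lemma cvg_pinfty_norm_ltP (R : realType) n (x : R -> 'cV[R]_n) (l : 'cV[R]_n) :
  x t @[t --> +oo] --> l <->
  forall e : R, 0 < e -> exists T, forall t, T <= t -> `|x t - l| < e.
Proof.
split=> [/cvgrPdist_lt xl e e0|xl].
  have [T [_ hT]] := xl e e0; exists (T + 1) => t Tt.
  by rewrite distrC; apply: hT; rewrite (lt_le_trans _ Tt)// ltrDl.
apply/cvgrPdist_lt => e e0; have [T hT] := xl e e0.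
by exists T; split; [exact: num_real|move=> t Tt; rewrite distrC hT// ltW].
Qed.

Section attraction.
Context (R : realType) (n : nat) (N : flow_network R n).
Hypothesis hN : monotone_network N.
Context (u xs : 'cV[R]_n).
Hypotheses (hu : admissible N u) (eqx : equilibrium N u xs).
Local Notation f x i := (vfield N x i 0).

(* A solution started at distance D >= rho from xs is shadowed by the solution
   started on the segment to xs at distance rho from xs, which converges; hence
   the distance drops below D - rho / 2 eventually. *)
Lemma local_to_global_attraction (d : R) : 0 < d ->
  (forall x, solution N (cst u) x -> `|x 0 - xs| < d -> x t @[t --> +oo] --> xs) ->
  forall x, solution N (cst u) x -> x t @[t --> +oo] --> xs.
Proof.
move=> d0 attr; pose rho := d / 2.
have rho0 : 0 < rho by rewrite divr_gt0.
have base x : solution N (cst u) x -> l1norm (x 0 - xs) < rho ->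
    x t @[t --> +oo] --> xs.
  move=> sx x0; apply: attr => //; apply: le_lt_trans (norm_le_l1norm _) _.
  by apply: lt_trans x0 _; rewrite /rho ltr_pdivrMr// mulr_natr mulr2n ltrDl.
have drop x : solution N (cst u) x -> rho <= l1norm (x 0 - xs) ->
    exists2 T, 0 <= T & l1norm (x T - xs) <= l1norm (x 0 - xs) - rho / 2.
  move=> sx; set D := l1norm _ => rhoD.
  have D0 : 0 < D by exact: lt_le_trans rhoD.
  (* Distances add along a segment: [q] is at l1-distance [rho] from [xs] and [D - rho] from
     [x 0]. *)
  pose th := rho / D.
  have th0 : 0 <= th by rewrite divr_ge0// ltW.
  have th1 : 0 <= 1 - th by rewrite subr_ge0 /th ler_pdivrMr// mul1r.
  pose q := xs + th *: (x 0 - xs).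
  have qxs : q - xs = th *: (x 0 - xs) by rewrite /q addrAC subrr add0r.
  have xq : x 0 - q = (1 - th) *: (x 0 - xs).
    by rewrite scalerBl scale1r /q opprD addrA.
  have thD : th * D = rho by rewrite /th divfK// gt_eqF.
  have q0 : orthant R n q.
    have [x0 _ _] := sx; have [xs0 _] := eqx.
    move=> i; have := x0 0 (lexx 0) i; have := xs0 i; rewrite !mxE.
    by move=> /(mulr_ge0 th1) h1 /(mulr_ge0 th0) h2; lra.
  have [y sy y0] := solution_exists hN hu q0.
  have : y t @[t --> +oo] --> xs.
    apply: attr => //; rewrite y0; apply: le_lt_trans (norm_le_l1norm _) _.
    by rewrite qxs l1normZ ger0_norm// thD /rho ltr_pdivrMr// mulr_natr mulr2n ltrDl.
  move=> /cvg_pinfty_norm_ltP yxs.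
  have [|T hT] := yxs (rho / 2 / (n%:R + 1)).
    by rewrite divr_gt0 ?divr_gt0// ltr_wpDl.
  exists (Num.max 0 T); first by rewrite le_max lexx.
  set T' := Num.max 0 T.
  have T'0 : 0 <= T' by rewrite le_max lexx.
  have /hT yT : T <= T' by rewrite le_max lexx orbT.
  have d1 : l1norm (x T' - y T') <= D - rho.
    have := l1norm_solutionB_nonincreasing hN (inflow_cst hu) sx sy (lexx 0) T'0.
    by rewrite y0 xq l1normZ ger0_norm// mulrBl mul1r thD.
  have d2 : l1norm (y T' - xs) <= rho / 2.
    apply: le_trans (l1norm_le_norm _) _.
    have n1 : 0 < n%:R + 1 :> R by rewrite ltr_wpDl.
    rewrite ltr_pdivlMr// mulrDr mulr1 mulrC in yT.
    by apply: le_trans (ltW yT); rewrite lerDl.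
  have -> : x T' - xs = (x T' - y T') + (y T' - xs) by rewrite addrA subrK.
  by apply: le_trans (l1normD _ _) _; lra.
(* Induction on the number of drops by [rho / 2] that suffice to get closer than [rho]; after a drop
   the trajectory is restarted at time [T]. *)
have rec (m : nat) : forall x, solution N (cst u) x ->
    l1norm (x 0 - xs) < rho + m%:R * (rho / 2) -> x t @[t --> +oo] --> xs.
  elim: m => [|m IH] x sx; first by rewrite mul0r addr0; exact: base.
  have [x0 _|rhox xm] := ltP (l1norm (x 0 - xs)) rho; first exact: base.
  have [T T0 xT] := drop x sx rhox.
  have /IH : solution N (cst u) (fun t => x (t + T)) by exact: solution_shift.
  rewrite add0r => /(_ _)/cvg_pinfty_norm_ltP-xT_cvg.
  apply/cvg_pinfty_norm_ltP => e e0.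
  have [|S hS] := xT_cvg _ e e0.
    by move: xm xT; rewrite -natr1 mulrDl mul1r; lra.
  exists (S + T) => t St; have := hS (t - T); rewrite subrK; apply.
  by rewrite lerBrDr.
move=> x sx.
have r20 : 0 < rho / 2 by rewrite divr_gt0.
have := archi_boundP (divr_ge0 (l1norm_ge0 (x 0 - xs)) (ltW r20)).
rewrite ltr_pdivrMr// => xm; apply: (rec (Num.bound (l1norm (x 0 - xs) / (rho / 2)))) => //.
by apply: lt_le_trans xm _; rewrite lerDr ltW.
Qed.

Context (G : 'M[R]_n).
Hypothesis gradG : has_gradient (vfield N) xs G.

Lemma has_gradient_ball (e : R) : 0 < e -> exists2 d : R, 0 < d &
  forall y, orthant R n y -> `|y - xs| < d ->
    forall i, `|f y i - f xs i - (G *m (y - xs)) i 0| <= e * `|y - xs|.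
Proof.
move=> e0; have := gradG e0; rewrite near_withinE => /nbhs_ballP[d /= d0 hd].
exists d => // y y0 yd i.
have : `|vfield N y - vfield N xs - G *m (y - xs)| <= e * `|y - xs|.
  by apply: hd => //; rewrite -ball_normE /= distrC.
apply: le_trans.
by have := coord_le_norm (vfield N y - vfield N xs - G *m (y - xs)) i; rewrite !cVBE.
Qed.

(** An almost everywhere hypothesis says nothing at the single point [xs]. The signs are read
    instead from the monotonicity of the field, along forward increments, which stay in the orthant
    even when [xs] is on the boundary. *)
Lemma has_gradient_compartmental : metzler G^T /\ G^T *m ones <=v 0.
Proof.
have [xs0 _] := eqx.
have increment (j : 'I_n) (e : R) : 0 < e -> exists2 h : R, 0 < h &
    [/\ orthant R n (xs + h *: delta_mx j 0), xs <=v xs + h *: delta_mx j 0 &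
    forall i, `|f (xs + h *: delta_mx j 0) i - f xs i - h * G i j| <= e * h].
  move=> e0; have [d d0 hd] := has_gradient_ball e0.
  have h0 : 0 < d / 2 by rewrite divr_gt0.
  have xsy : xs <=v xs + (d / 2) *: delta_mx j 0.
    by move=> i; rewrite !mxE lerDl mulr_ge0 ?ler0n// ltW.
  have yO : orthant R n (xs + (d / 2) *: delta_mx j 0).
    by move=> i; exact: le_trans (xs0 i) (xsy i).
  have nrm : `|(d / 2) *: delta_mx j 0 : 'cV[R]_n| <= d / 2.
    apply: cV_norm_le => [|i]; first exact: ltW.
    rewrite !mxE; case: (_ && _); rewrite ?mulr1 ?mulr0 ?normr0 ?(ltW h0)//.
    by rewrite ger0_norm// ltW.
  exists (d / 2) => //; split => // i.
  set y := xs + _ in yO *.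
  have yxs : y - xs = (d / 2) *: delta_mx j 0 by rewrite /y addrAC subrr add0r.
  have yd : `|y - xs| < d.
    by rewrite yxs (le_lt_trans nrm)// ltr_pdivrMr// mulr_natr mulr2n ltrDl.
  have Gy : (G *m (y - xs)) i 0 = d / 2 * G i j.
    by rewrite yxs -scalemxAr mxE -colE mxE.
  have := hd y yO yd i; rewrite Gy => /le_trans; apply.
  by rewrite yxs ler_wpM2l// ltW.
split=> [j i ji|j].
  rewrite mxE; apply/ler_addgt0Pr => e e0.
  have [h h0 [yO xsy hG]] := increment j e e0.
  have fmono : f xs i <= f (xs + h *: delta_mx j 0) i.
    apply: (vfield_quasimonotone hN) => //.
    by rewrite !mxE eq_sym (negbTE ji) mulr0 addr0.
  have := hG i; rewrite ler_norml => /andP[_ le1].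
  rewrite -(pmulr_rge0 _ h0) mulrDr; move: le1; rewrite (mulrC e); lra.
rewrite [leRHS]mxE; apply/ler_addgt0Pr => e e0; rewrite add0r.
have n1 : 0 < n%:R + 1 :> R by rewrite ltr_wpDl.
(* The errors of the [n] cells add up, hence the tolerance [e / (n + 1)] for each. *)
have [h h0 [yO xsy hG]] := increment j _ (divr_gt0 e0 n1).
have := sum_vfield_antimonotone hN xs0 xsy; rewrite -subr_le0 -sumrB => fsum.
rewrite mxE; under eq_bigr do rewrite !mxE mulr1.
rewrite -(ler_pM2l h0) mulr_sumr.
apply: (@le_trans _ _ (\sum_i (f (xs + h *: delta_mx j 0) i - f xs i) + \sum_(i < n) (e / (n%:R + 1) * h))).
  rewrite -big_split/=; apply: ler_sum => i _.
  by have := hG i; rewrite ler_norml => /andP[le1 _]; lra.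
apply: le_trans (lerD fsum (lexx _)) _.
rewrite add0r sumr_const card_ord -[leLHS]mulr_natl mulrA (mulrC h) ler_wpM2r ?(ltW h0)//.
by rewrite mulrCA ger_pMr// ler_pdivrMr// mul1r lerDl.
Qed.

End attraction.

(** * Local asymptotic stability by linearisation *)

Section linearised_stability.
Context (R : realType) (n : nat) (N : flow_network R n).
Hypothesis hN : monotone_network N.
Context (u xs : 'cV[R]_n) (G : 'M[R]_n).
Hypotheses (hu : admissible N u) (eqx : equilibrium N u xs).
Hypothesis gradG : has_gradient (vfield N) xs G.
Hypothesis connG : outflow_connected G^T.
Local Notation f x i := (vfield N x i 0).

Lemma weighted_l1norm_decay : exists (p : 'cV[R]_n) (c d : R),
  [/\ forall i, 0 < p i 0, 0 < c, 0 < d &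
    forall x, solution N (cst u) x ->
      (forall t, 0 <= t -> `|x t - xs| < d) -> forall t, 0 <= t ->
      dini_le (fun t => \sum_i p i 0 * `|x (Num.max 0 t) i 0 - xs i 0|) t
        (- c * l1norm (x t - xs))].
Proof.
have [metzlerG G1] := has_gradient_compartmental hN eqx gradG.
have [p [p0 Gp]] := outflow_connected_weight metzlerG G1 connG.
have [c c0 Gpc] : exists2 c : R, 0 < c & forall i, (G^T *m p) i 0 <= - c.
  (* The default value 1 keeps the minimum positive even without cells. *)
  exists (\big[Num.min/1]_i (- (G^T *m p) i 0)).
    by apply/bigmin_gtP; split => // i _; rewrite oppr_gt0.
  by move=> i; rewrite lerNr; exact: bigmin_le_cond.
have S0 : 0 <= \sum_i p i 0 by apply: sumr_ge0 => i _; exact: ltW.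
have S1 : 0 < 2 * (\sum_i p i 0 + 1) by rewrite mulr_gt0// ltr_wpDl.
(* With this tolerance the linearisation error, weighted by [p], uses up at most half of [c]. *)
have [d d0 hd] := has_gradient_ball gradG (divr_gt0 c0 S1).
exists p, (c / 2), d; split => //; first exact: divr_gt0.
move=> x sx xd t t0.
set z := x t - xs.
have zE i : z i 0 = x t i 0 - xs i 0 by rewrite cVBE.
pose h : 'cV[R]_n := \col_i (f (x t) i - f xs i).
(* Where [z i 0 = 0] the sign follows the rate, so that [s i 0 * h i 0] is the absolute value of
   [h i 0], as the kink requires. *)
pose s : 'cV[R]_n := \col_i (if (0 < z i 0) || (z i 0 == 0) && (0 <= h i 0)
  then 1 else - 1).
have ss := equilibrium_solution eqx.
have uu (r : R) : 0 <= r -> cst u r <=v cst u r by move=> _ i.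
have di i : dini_le (fun t => `|x (Num.max 0 t) i 0 - xs i 0|) t (s i 0 * h i 0).
  apply: (@dini_le_norm _ _ _ (h i 0)).
  - apply: cvg_at_right_filter; apply: cvgB; last exact: cvg_cst.
    by have /(_ t) := @continuous_solution_coord _ _ _ _ _ i sx.
  - rewrite mxE.
    exact: (dini_le_solutionB hN i (inflow_cst hu) (inflow_cst hu) sx ss uu t0).
  - rewrite mxE opprB.
    have := dini_le_solutionB hN i (inflow_cst hu) (inflow_cst hu) ss sx uu t0.
    apply: near_eq_dini_le; first by rewrite opprB.
    by apply: nearW => r; rewrite opprB.
  - rewrite (max_idPr t0) -zE [s _ _]mxE; case: ltgtP => //= [_|_] _.
      by rewrite mul1r.
    by have [h0|/ltW h0] := leP 0 (h i 0); rewrite ?mul1r ?mulN1r; lra.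
  - rewrite (max_idPr t0) -zE [s _ _]mxE; case: ltgtP => //= [_|_] _.
      by rewrite mulN1r.
    by have [h0|/ltW h0] := leP 0 (h i 0); rewrite ?mul1r ?mulN1r; lra.
apply: dini_leW (dini_le_sum (index_enum _) (fun i => dini_leZ (ltW (p0 i)) (di i))).
apply: le_trans (weighted_decay (z := z) (e := c / (2 * (\sum_i p i 0 + 1))) metzlerG p0 Gpc _ _ _) _.
- move=> i; have [x0 _ _] := sx.
  rewrite [h _ _]mxE; apply: le_trans (hd _ (x0 t t0) (xd t t0) i) _.
  by apply: ler_wpM2l; [rewrite divr_ge0 ?ltW|exact: norm_le_l1norm].
- by move=> i; rewrite mxE; case: ifP => _; rewrite ?normrN normr1.
- move=> i; rewrite [s _ _]mxE; have [z0|z0|z0] := ltgtP 0 (z i 0) => /=.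
  + by rewrite mul1r gtr0_norm.
  + by rewrite mulN1r ltr0_norm.
  + by rewrite -z0 normr0 mulr0.
apply: ler_wpM2r; first exact: l1norm_ge0.
have : c / (2 * (\sum_i p i 0 + 1)) * (\sum_i p i 0) <= c / 2.
  rewrite invfM mulrA -mulrA ler_piMr//; first by rewrite divr_ge0 ?ltW.
  by rewrite mulrC ler_pdivrMr ?mul1r ?lerDl// ltr_wpDl.
by lra.
Qed.

(** Stability confines the trajectory to the ball where the decay estimate holds. Since the
    l1-distance never increases, a single time at which it is below [e] suffices. *)
Lemma linearised_attraction : locally_asymptotically_stable N u xs.
Proof.
have stab := stable_equilibrium hN hu eqx.
split => //.
have [p [c [d [p0 c0 d0 decay]]]] := weighted_l1norm_decay.
have [d' d'0 near_xs] := stab _ d0.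
exists d' => // x sx x0.
have xd := near_xs x sx x0.
pose V t := \sum_i p i 0 * `|x (Num.max 0 t) i 0 - xs i 0|.
have V0 t : 0 <= V t by apply: sumr_ge0 => i _; rewrite mulr_ge0// ltW.
have cV : continuous V.
  apply: continuous_big => [|i _ t]; first exact: add_continuous.
  apply: cvgM; first exact: cvg_cst.
  apply: cvg_norm; apply: cvgB; last exact: cvg_cst.
  by have /(_ t) := @continuous_solution_coord _ _ _ _ _ i sx.
have l1_mono := l1norm_solutionB_nonincreasing hN (inflow_cst hu) sx (equilibrium_solution eqx).
apply/cvg_pinfty_norm_ltP => e e0.
have ce0 : 0 < c * e by exact: mulr_gt0.
(* Were the distance at least [e] up to time [T], [V] would lose [V 0 + 1] and become negative. *)
pose T := (V 0 + 1) / (c * e).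
have T0 : 0 <= T by rewrite divr_ge0 ?addr_ge0// ltW.
exists T => t Tt; apply: le_lt_trans (norm_le_l1norm _) _.
apply: le_lt_trans (l1_mono _ _ T0 Tt) _; rewrite ltNge; apply/negP => eT.
have : V T - V 0 <= (- (c * e)) * (T - 0).
  apply: dini_le_growth => // r /andP[r0 rT].
  apply: dini_leW (decay x sx xd r r0).
  rewrite mulNr lerN2 ler_wpM2l ?(ltW c0)// (le_trans eT)//.
  by apply: l1_mono => //; exact: ltW.
have cT : c * e * T = V 0 + 1 by rewrite /T [LHS]mulrC divfK ?gt_eqF.
by rewrite subr0 mulNr cT; have := V0 T; lra.
Qed.

End linearised_stability.

Theorem theorem6 (R : realType) (n : nat) (N : flow_network R n)
    (hN : monotone_network N) :
  (forall u u' x x' : R -> 'cV[R]_n,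
     inflow N u -> inflow N u' -> solution N u x -> solution N u' x' ->
     x 0 <=v x' 0 -> (forall t, 0 <= t -> u t <=v u' t) ->
     forall t, 0 <= t -> x t <=v x' t) /\
  (forall u x x' : R -> 'cV[R]_n,
     inflow N u -> solution N u x -> solution N u x' ->
     forall s t, 0 <= s -> s <= t ->
       l1norm (x t - x' t) <= l1norm (x s - x' s)) /\
  (forall u : 'cV[R]_n, admissible N u ->
     [/\ forall xs, equilibrium N u xs -> stable N u xs,
         forall xs, equilibrium N u xs ->
           (globally_asymptotically_stable N u xs <->
            locally_asymptotically_stable N u xs),
         forall xs G, equilibrium N u xs -> has_gradient (vfield N) xs G ->
           outflow_connected G^T -> locally_asymptotically_stable N u xs &
         forall x, solution N (cst u) x -> x 0 = 0 ->
           (forall s t, 0 <= s -> s <= t -> x s <=v x t) /\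
           (forall i, exists l : \bar R, (x t i 0)%:E @[t --> +oo] --> l)]).
Proof.
split; first exact: solution_le.
split; first exact: l1norm_solutionB_nonincreasing.
move=> u hu; split.
- by move=> xs; exact: stable_equilibrium.
- move=> xs eqx; split=> [[stab attr]|[stab [d d0 attr]]]; split => //.
    by exists 1 => // x sx _; exact: attr.
  exact: (local_to_global_attraction hN hu eqx d0).
- by move=> xs G eqx gradG connG; exact: (linearised_attraction hN hu eqx gradG).
- move=> x sx x0.
  have xmono := solution_from0_nondecreasing hN hu sx x0.
  split => // i; apply: nondecreasing_ex_limit => s t s0 st.
  exact: xmono.
Qed.
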